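(* Let $m\in\mathbb{N}$, let $f\colon[0,1]\to[0,1]$ be a piecewise expanding map on $m$ intervals and let $\mu$ be an acip of $f$. Then the periodic points of $f$ are dense in $\operatorname{supp}\mu$.
   Context: A map $f\colon[0,1]\to[0,1]$ is piecewise expanding on $m$ intervals if there are a constant $\sigma>1$ and intervals $I_1,\dots,I_m$ such that (1) $[0,1]=\bigcup_{i=1}^m I_i$ and $\mathrm{int}(I_i)\cap\mathrm{int}(I_j)=\emptyset$ for $i\ne j$; (2) $f$ is $C^1$ and $|f'|\ge\sigma$ on each $I_i$; (3) $f'$ is Lipschitz on each $I_i$. An acip of $f$ is an $f$-invariant Borel probability measure absolutely continuous with respect to Lebesgue measure on $[0,1]$. $\operatorname{supp}\mu$ is the smallest closed set of full $\mu$-measure. *)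

(* Defs.v *)
From HB Require Import structures.
From mathcomp Require Import all_boot all_order all_algebra.
From mathcomp Require Import all_classical all_reals all_analysis measurable_realfun.
Set Implicit Arguments.
Unset Strict Implicit.
Unset Printing Implicit Defensive.
Import Order.TTheory GRing.Theory Num.Theory.
Import numFieldTopology.Exports numFieldNormedType.Exports.
Local Open Scope classical_set_scope.
Local Open Scope ring_scope.

(* A self-map of [0,1] is represented by a function f : R -> R such that
   set_fun `[0, 1] `[0, 1] f; its values outside [0,1] play no role. *)

(* The derivative of f relative to A: it is one-sided at the endpoints of an
   interval A, and the values of f outside A are irrelevant. *)
Definition is_derivative_on (R : realType) (A : set R) (f f' : R -> R) : Prop :=
  forall x, A x ->
    (fun y => (f y - f x) / (y - x)) @ within A x^' --> f' x.

(* The intervals may be open, closed or half-open; a one-point interval is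
   allowed and imposes no condition on f. *)
Definition piecewise_expanding (R : realType) (m : nat) (f : R -> R) : Prop :=
  exists (sigma : R) (I : 'I_m -> interval R),
    [/\ 1 < sigma,
        `[0, 1]%classic = \bigcup_i [set` I i],
        forall i j, i != j -> [set` I i]° `&` [set` I j]° = set0 &
        forall i, exists f' : R -> R,
          [/\ is_derivative_on [set` I i] f f',
              {within [set` I i], continuous f'},
              forall x, x \in I i -> sigma <= `|f' x| &
              [lipschitz f' x | x in [set` I i]]]].

(* Borel probability measures on [0,1] are probability measures on the Borel
   sets of R that give full mass to [0,1]. *)
Definition acip (R : realType) (f : R -> R)
    (mu : probability (measurableTypeR R) R) : Prop :=
  [/\ mu `[0, 1]%classic = 1%E,
      forall A : set (measurableTypeR R), measurable A ->
        mu (`[0, 1]%classic `&` f @^-1` A) = mu A &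
      mu `<< @lebesgue_measure R].

Definition msupport (R : realType) (mu : probability (measurableTypeR R) R) :
    set R :=
  \bigcap_(C in [set C : set R | closed C /\ mu C = 1%E]) C.

Definition periodic_points (R : realType) (f : R -> R) : set R :=
  [set x | x \in `[0, 1] /\ exists n, (0 < n)%N /\ iter n f x = x].

Lemma closed_msupport (R : realType) (mu : probability (measurableTypeR R) R) :
  closed (msupport mu).
Proof. by apply: closed_bigI => C []. Qed.

Lemma msupport_min (R : realType) (mu : probability (measurableTypeR R) R)
  (C : set R) : closed C -> mu C = 1%E -> msupport mu `<=` C.
Proof. by move=> cC muC x; apply. Qed.

Lemma msupport_full (R : realType) (mu : probability (measurableTypeR R) R) :
  mu (msupport mu) = 1%E.
Proof.
pose J (q : rat * rat) : set R := `]ratr q.1, ratr q.2[%classic.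
have closedM (C : set R) : closed C -> measurable (C : set (measurableTypeR R)).
  by move=> /closed_openC/open_measurable/measurableC; rewrite setCK.
have mS := closedM _ (@closed_msupport R mu).
suff S0 : mu (~` msupport mu) = 0%E.
  by rewrite -[msupport mu]setCK probability_setC ?S0 ?sube0//; exact: measurableC.
apply/negligibleP; first exact: measurableC.
pose F k : set R :=
  if unpickle k is Some q then if mu (J q) == 0%E then J q else set0 else set0.
suff sub : ~` msupport mu `<=` \bigcup_k F k.
  apply: (@negligibleS _ (measurableTypeR R) R mu _ _ sub).
  apply: negligible_bigcup => k; rewrite /F.
  case: unpickle => [q|]; last exact: negligible_set0.
  case: ifPn => [/eqP Jq0|_]; last exact: negligible_set0.
  by apply/negligibleP; [apply: measurable_itv|exact: Jq0].
move=> x /existsNP[C] /not_implyP[[cC muC] nCx].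
have oC : open (~` C) by exact: closed_openC.
have /nbhs_ballP[e /= e0 eC] : nbhs x (~` C) by exact: open_nbhs_nbhs.
have [a] : exists q, ratr q \in `]x - e, x[.
  by apply/rat_in_itvoo; rewrite ltrBlDr ltrDl.
have [b] : exists q, ratr q \in `]x, x + e[.
  by apply/rat_in_itvoo; rewrite ltrDl.
rewrite !in_itv/= => /andP[xb be] /andP[ea ax].
have Jab0 : mu (J (a, b)) = 0%E.
  apply/eqP; rewrite -measure_le0.
  have <- : mu (~` C) = 0%E.
    by rewrite probability_setC ?muC ?subee//; exact: closedM.
  apply: le_measure; rewrite ?inE.
  - by apply: measurable_itv.
  - by apply: measurableC; apply: closedM.
  move=> y; rewrite /J/= in_itv/= => /andP[ay yb]; apply: eC => /=.
  rewrite /ball/= ltr_distlC; apply/andP; split; first exact: lt_trans ay.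
  exact: lt_trans be.
have FJ q : mu (J q) = 0%E -> J q x -> (\bigcup_k F k) x.
  move=> Jq0 Jx; exists (pickle q); first exact: I.
  by rewrite /F pickleK; case: ifPn => // /eqP.
have Jx : J (a, b) x by rewrite /J /= in_itv /= ax xb.
exact (FJ (a, b) Jab0 Jx).
Qed.

(* Main.v *)
Require Import Defs.
From mathcomp Require Import all_boot all_order all_algebra.
From mathcomp Require Import all_classical all_reals all_analysis.
From mathcomp Require Import measurable_realfun ring lra.
Set Implicit Arguments.
Unset Strict Implicit.
Unset Printing Implicit Defensive.
Import Order.TTheory GRing.Theory Num.Theory.
Import numFieldTopology.Exports numFieldNormedType.Exports.
Local Open Scope classical_set_scope.
Local Open Scope ring_scope.

(* Let C be the finite set of cut points, G the interior of supp mu.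

   Small intervals are cut more slowly than they grow: if sigma^N >= 4, a
   short interval meets at most one cut point of f^N, so that in N steps the
   number of pieces at most doubles while the bound sigma^-n on the length
   of a piece that has survived for n steps is divided by at least 4. Hence
   any interval is, up to a set of measure zero, a disjoint union of
   intervals that some iterate of f maps diffeomorphically and with bounded
   distortion onto an interval of length at least a fixed delta.

   G is not empty: supp mu is closed and f maps it to itself off C, so if it
   had empty interior, every interval of length delta would contain a gap of
   supp mu of length bounded below; pulled back with bounded distortion,
   these gaps fill a fixed proportion of every interval, and supp mu would
   be a null set by the Lebesgue density theorem. Applied to mu conditioned
   on the complement of G, which is again an acip, this gives mu(G) = 1.

   It remains to find a periodic point in any interval Q inside G. Cut [0,1]
   in finitely many intervals K_i of length less than delta / 3, and shrink
   Q until the set of those K_i that are covered by some subinterval of Q is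
   the same for all subintervals of Q. Let J in Q be mapped onto K_i by f^n.
   By Poincare recurrence some y in K_i, and hence a neighbourhood Y of y in
   K_i, is mapped into J, onto an interval Y'. By the choice of Q some J' in
   Y' is mapped by f^m onto K_i, which contains Y; hence some part of J' is
   mapped by f^m onto Y and then by f^t onto Y', which contains J'. *)

(** * Mean value theorem, expansion and distortion on a single interval *)

Section derivative_on.
Variables (R : realType) (f f' : R -> R).

Lemma is_derivative_on_dist (A : set R) (x e : R) :
  is_derivative_on A f f' -> A x -> 0 < e ->
  exists2 d, 0 < d & forall y, A y -> y != x -> `|x - y| < d ->
    `|f' x - (f y - f x) / (y - x)| <= e.
Proof.
move=> Af Ax e0; move/cvgrPdist_le : (Af _ Ax) => /(_ _ e0).
case/nbhs_ballP => d d0 dP; exists d => // y Ay yx xyd.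
exact: (dP y).
Qed.

Lemma is_derivative_on_continuous (A : set R) :
  is_derivative_on A f f' -> {within A, continuous f}.
Proof.
move=> Af; apply/subspace_continuousP => x Ax.
have [d d0 dP] := is_derivative_on_dist Af Ax ltr01.
apply/cvgrPdist_le => e e0; apply/nbhs_ballP.
(* Near [x] the difference quotient is bounded by [K]. *)
pose K := `|f' x| + 1; have K0 : 0 < K by rewrite ltr_wpDl.
exists (Num.min d (e / K)) => /=; first by rewrite lt_min d0 divr_gt0.
move=> y; rewrite /ball/= lt_min => /andP[yd ye] Ay.
have [->|yx] := eqVneq y x; first by rewrite subrr normr0 ltW.
have yx0 : `|y - x| > 0 by rewrite normr_gt0 subr_eq0.
have := dP _ Ay yx yd; rewrite distrC => q.
have {q} q : `|(f y - f x) / (y - x)| <= K.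
  have := ler_normD ((f y - f x) / (y - x) - f' x) (f' x).
  by rewrite subrK /K => /le_trans; apply; rewrite addrC lerD2l.
rewrite distrC.
have -> : f y - f x = (f y - f x) / (y - x) * (y - x).
  by rewrite divfK// subr_eq0.
rewrite normrM; apply: (@le_trans _ _ (K * `|y - x|)); first by rewrite ler_wpM2r.
by rewrite mulrC -ler_pdivlMr// distrC ltW.
Qed.

Lemma is_derivative_on_is_derive (A : set R) (x : R) :
  is_derivative_on A f f' -> nbhs x A -> is_derive x 1 f (f' x).
Proof.
move=> Af nA; have Ax : A x := nbhs_singleton nA.
have : (fun h => h^-1 *: (f (h *: 1 + x) - f x)) @ 0^' --> f' x.
  apply/cvgrPdist_le => e e0; have [d d0 dP] := is_derivative_on_dist Af Ax e0.
  have /nbhs_ballP[r r0 rA] := nA.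
  apply/nbhs_ballP; exists (Num.min d r) => /=; first by rewrite lt_min d0.
  move=> h; rewrite /ball/= sub0r normrN lt_min => /andP[hd hr] h0.
  have := dP (h + x); rewrite opprD addrCA subrr addr0 normrN addrK.
  rewrite [_ / h]mulrC [h *: 1]mulr1; apply => //.
    by apply: rA; rewrite /ball/= opprD addrCA subrr addr0 normrN.
  by rewrite -subr_eq0 addrK.
move=> cf; apply: DeriveDef.
  by apply/cvg_ex; exists (f' x).
exact/cvg_lim.
Qed.

(** The relative derivative is an ordinary one inside [I]; at [x] and [y], which may be endpoints of
    [I], continuity within [I] is enough. *)
Lemma is_derivative_on_MVT (I : interval R) (x y : R) :
  is_derivative_on [set` I] f f' -> x \in I -> y \in I -> x < y ->
  exists c, [/\ c \in I, x < c < y & f y - f x = f' c * (y - x)].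
Proof.
move=> If xI yI xy.
have sub : `[x, y]%classic `<=` [set` I].
  move=> z /=; rewrite in_itv/= => /andP[xz zy].
  by apply: (interval_is_interval xI yI); rewrite xz zy.
case: (@MVT R f f' x y xy) => [z||z zI fE].
- rewrite in_itv/= => zI.
  apply: (@is_derivative_on_is_derive [set` I]) => //.
  apply: (@filterS _ _ _ `]x, y[%classic).
    by move=> u /subset_itv_oo_cc/sub.
  by apply: near_in_itvoo; rewrite in_itv.
- by apply: (continuous_subspaceW sub); exact: is_derivative_on_continuous If.
- exists z; split => //.
  by apply: sub => /=; apply: subset_itv_oo_cc.
Qed.

Lemma is_derivative_on_expand (I : interval R) (sigma : R) :
  is_derivative_on [set` I] f f' ->
  (forall x, x \in I -> sigma <= `|f' x|) ->
  {in I &, forall x y, sigma * `|x - y| <= `|f x - f y|}.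
Proof.
move=> If sf x y; wlog xy : x y / x < y.
  move=> H xI yI; have [xy|yx|->] := ltgtP x y; first exact: H.
    by rewrite distrC [`|f x - _|]distrC; exact: H.
  by rewrite !subrr normr0 mulr0.
move=> xI yI.
have [c [cI _ E]] := is_derivative_on_MVT If xI yI xy.
by rewrite distrC [`|f x - _|]distrC E normrM ler_wpM2r// sf.
Qed.

(** The increments are [|f' s|] and [|f' t|] times the distances, with [|s - t| <= d]. The Lipschitz
    bound gives [|f' s| <= |f' t| + M d], and [|f' t| >= 1] turns the additive error into the factor
    [1 + M d]. *)
Lemma is_derivative_on_distortion (I : interval R) (M d : R) :
  is_derivative_on [set` I] f f' -> 0 <= M ->
  (forall x, x \in I -> 1 <= `|f' x|) ->
  {in I &, forall x y, `|f' x - f' y| <= M * `|x - y|} ->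
  forall x y u v, x \in I -> y \in I -> u \in I -> v \in I ->
  (forall a b, a \in [:: x; y; u; v] -> b \in [:: x; y; u; v] -> `|a - b| <= d) ->
  `|f x - f y| * `|u - v| <= (1 + M * d) * (`|f u - f v| * `|x - y|).
Proof.
move=> If M0 f1 fM.
(* By symmetry both pairs may be taken in increasing order. *)
have fin (P : R -> R -> R -> R -> Prop) :
    (forall x y u v, P x y u v -> P y x u v) ->
    (forall x y u v, P x y u v -> P x y v u) ->
    (forall x y u v, x <= y -> u <= v -> P x y u v) ->
    forall x y u v, P x y u v.
  move=> P1 P2 Q x y u v.
  by have [xy|/ltW xy] := leP x y; have [uv|/ltW uv] := leP u v;
    [|apply: P2|apply: P1|apply: P1; apply: P2]; apply: Q.
move=> x y u v; pattern x, y, u, v; apply: fin => {x y u v}.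
- move=> x y u v H xI yI uI vI dH.
  rewrite [`|f y - _|]distrC [`|y - x|]distrC; apply: H => // a b aI bI.
  by apply: dH; [move: aI | move: bI]; rewrite !inE orbCA.
- move=> x y u v H xI yI uI vI dH.
  rewrite [`|f v - _|]distrC [`|v - u|]distrC; apply: H => // a b aI bI.
  apply: dH; [move: aI | move: bI]; rewrite !inE => /or4P[]/eqP->;
    by rewrite eqxx ?orbT.
move=> x y u v; rewrite le_eqVlt => /predU1P[<- _ _ _ _ _ _|xy].
  by rewrite !subrr normr0 mul0r !mulr0.
rewrite le_eqVlt => /predU1P[<- _ _ _ _ _|uv].
  by rewrite !subrr normr0 mul0r !mulr0.
move=> xI yI uI vI dH.
have [s [sI /andP[xs sy] ->]] : exists s,
    [/\ s \in I, x < s < y & `|f x - f y| = `|f' s| * `|x - y|].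
  have [s [? ? E]] := is_derivative_on_MVT If xI yI xy.
  by exists s; rewrite [`|f x - _|]distrC E normrM [`|y - x|]distrC.
have [t [tI /andP[ut tv] ->]] : exists t,
    [/\ t \in I, u < t < v & `|f u - f v| = `|f' t| * `|u - v|].
  have [t [? ? E]] := is_derivative_on_MVT If uI vI uv.
  by exists t; rewrite [`|f u - _|]distrC E normrM [`|v - u|]distrC.
(* Here [s - t < y - u] and [t - s < v - x]. *)
have std : `|s - t| <= d.
  have := dH x v; have := dH u y; rewrite !inE !eqxx/= !orbT => /(_ isT isT) + /(_ isT isT).
  by rewrite !ler_norml => /andP[? ?] /andP[? ?]; apply/andP; split; lra.
have fst : `|f' s| <= (1 + M * d) * `|f' t|.
  have : `|f' s| <= `|f' t| + M * d.
    rewrite -[f' s](subrK (f' t)) (le_trans (ler_normD _ _))// addrC lerD2l.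
    by rewrite (le_trans (fM _ _ sI tI))// ler_wpM2l.
  move/le_trans; apply; rewrite mulrDl mul1r lerD2l ler_peMr ?f1// mulr_ge0//.
  exact: le_trans std.
rewrite [X in _ <= X](_ : _ = (1 + M * d) * `|f' t| * (`|x - y| * `|u - v|)); last by ring.
by rewrite -mulrA ler_wpM2r// mulr_ge0.
Qed.

End derivative_on.

(** * Expansion off a finite set of cut points *)

(** One finite set [C] replaces the family of intervals. It contains 0 and 1, so that a point of
    [0,1] off [C] has a neighbourhood inside [0,1]. *)
Record expanding_off (R : realType) (f : R -> R) (C : set R) (sigma L : R) : Prop :=
  ExpandingOff {
  exp_itv : set_fun `[0, 1]%classic `[0, 1]%classic f;
  exp_finite : finite_set C;
  exp_cut0 : C 0;
  exp_cut1 : C 1;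
  exp_gt1 : 1 < sigma;
  exp_lip : 0 <= L;
  exp_continuous : forall a b, 0 <= a -> b <= 1 ->
    (forall x, a < x < b -> ~ C x) ->
    forall x, a < x < b -> {for x, continuous f};
  exp_expand : forall a b, 0 <= a -> b <= 1 ->
    (forall x, a < x < b -> ~ C x) ->
    forall x y, a < x < b -> a < y < b -> sigma * `|x - y| <= `|f x - f y|;
  (* the quotient of two difference quotients is at most 1 + L d *)
  exp_distortion : forall a b d, 0 <= a -> b <= 1 ->
    (forall x, a < x < b -> ~ C x) ->
    (forall x y, a < x < b -> a < y < b -> `|x - y| <= d) ->
    forall x y u v, a < x < b -> a < y < b -> a < u < b -> a < v < b ->
    `|f x - f y| * `|u - v| <= (1 + L * d) * (`|f u - f v| * `|x - y|);
  exp_fiber : forall y, finite_set (`[0, 1]%classic `&` f @^-1` [set y]);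
  exp_measurable : measurable_fun (`[0, 1]%classic : set (measurableTypeR R))
    (f : measurableTypeR R -> measurableTypeR R) }.

Definition itv_bound_seq (R : realType) (b : itv_bound R) : seq R :=
  if b is BSide _ x then [:: x] else [::].

(** If [y] were outside [I], an endpoint of [I] would lie between [x] and [y], hence in ]a, b[. *)
Lemma itv_no_endpoint (R : realType) (I : interval R) (a b x : R) :
  (forall z, a < z < b -> z \notin itv_bound_seq I.1 ++ itv_bound_seq I.2) ->
  a < x < b -> x \in I -> forall y, a < y < b -> y \in I.
Proof.
case: I => l r H /andP[ax xb]; rewrite itv_boundlr => /andP[lx xr] y /andP[ay yb].
rewrite itv_boundlr; apply/andP; split.
- case: l lx H => [c p|[]]// px H.
  have : ~ (a < p < b) by move/H; rewrite /= mem_head.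
  case: c px {H}; rewrite !bnd_simp => px pab; rewrite leNgt || rewrite ltNge;
    apply/negP => yp; apply: pab; apply/andP; split; lra.
- case: r xr H => [c p|[]]// px H.
  have : ~ (a < p < b) by move/H; rewrite mem_cat mem_head orbT.
  case: c px {H}; rewrite !bnd_simp => px pab; rewrite leNgt || rewrite ltNge;
    apply/negP => yp; apply: pab; apply/andP; split; lra.
Qed.

(** [C] consists of 0, 1 and all endpoints of the [I i]. An interval ]a, b[ without cut points lies
    in a single [I i], namely one that contains its midpoint. Fibres are finite because [f] is
    injective on each [I i]. *)
Lemma piecewise_expanding_off (R : realType) (m : nat) (f : R -> R) :
  set_fun `[0, 1]%classic `[0, 1]%classic f -> piecewise_expanding m f ->
  exists C sigma L, expanding_off f C sigma L.
Proof.
move=> f01 [sigma [I [sigma1 I01 _ Hf]]].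
have [f' f'P] := choice Hf.
have [M M0 MP] : exists2 M, 0 <= M & forall i,
    {in I i &, forall x y, `|f' i x - f' i y| <= M * `|x - y|}.
  have Hl i : exists M, 0 <= M /\
      {in I i &, forall x y, `|f' i x - f' i y| <= M * `|x - y|}.
    have [_ _ _ /pinfty_ex_gt0[M M0 MP]] := f'P i.
    exists M; split; first exact: ltW.
    by move=> x y xI yI; exact: (MP (x, y) (conj xI yI)).
  have [M MP] := choice Hl; exists (\sum_i M i).
    by apply: sumr_ge0 => i _; have [] := MP i.
  move=> i x y xI yI; have [_ /(_ x y xI yI)/le_trans] := MP i; apply.
  rewrite ler_wpM2r// (bigD1 i)//= lerDl; apply: sumr_ge0 => j _.
  by have [] := MP j.
pose s := [:: 0; 1] ++ flatten
  [seq itv_bound_seq (I i).1 ++ itv_bound_seq (I i).2 | i <- enum 'I_m].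
have subI a b : 0 <= a -> b <= 1 -> (forall x, a < x < b -> ~ [set` s] x) ->
    exists2 i, True & forall x, a < x < b -> x \in I i.
  move=> a0 b1 sab.
  (* If [b <= a], then ]a, b[ is empty and any index will do; the point 0 supplies one. *)
  have : `[0, 1]%classic (if a < b then (a + b) / 2 else 0).
    by rewrite /= in_itv/=; case: ifP => ab; apply/andP; split => //; lra.
  rewrite I01 => -[i _ /= Ii]; exists i => // x /[dup] xab /andP[ax xb].
  move: Ii; rewrite (lt_trans ax xb) => Ii.
  apply: (itv_no_endpoint _ _ Ii xab); last by apply/andP; split; lra.
  move=> z /sab /negP; apply: contra => zI; rewrite /= /s mem_cat; apply/orP; right.
  by apply/flatten_mapP; exists i => //; rewrite mem_enum.
have s0 : [set` s] 0 by rewrite /= /s mem_head.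
have s1 : [set` s] 1 by rewrite /= /s in_cons mem_head orbT.
exists [set` s], sigma, M; split => //.
- exact: finite_seq.
- move=> a b a0 b1 ab x xab; have [i _ iP] := subI _ _ a0 b1 ab.
  have [df _ _ _] := f'P i.
  move/subspace_continuousP : (is_derivative_on_continuous df) => /(_ x (iP _ xab)).
  have nx : \forall y \near x, [set` I i] y.
    apply: (@filterS _ _ _ `]a, b[%classic) => [y /=|].
      by rewrite in_itv; exact: iP.
    by apply: near_in_itvoo; rewrite in_itv.
  by move=> cf U /cf; apply: filterS2 nx => y Iy; exact.
- move=> a b a0 b1 ab x y xab yab; have [i _ iP] := subI _ _ a0 b1 ab.
  have [df _ sf _] := f'P i.
  by apply: (is_derivative_on_expand df sf); exact: iP.
- move=> a b d a0 b1 ab dP x y u v xab yab uab vab.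
  have [i _ iP] := subI _ _ a0 b1 ab.
  have [df _ sf _] := f'P i.
  apply: (@is_derivative_on_distortion _ f (f' i) (I i)); try exact: iP => //.
  + exact: df.
  + exact: M0.
  + by move=> z /sf; apply: le_trans; exact: ltW.
  + exact: MP.
  + by move=> z w; rewrite !inE => /or4P[]/eqP-> /or4P[]/eqP->; exact: dP.
- move=> y; rewrite I01 setI_bigcupl; apply: bigcup_finite => // i _.
  have [[x [xI fx]]|no] := pselect (exists x, x \in I i /\ f x = y).
    apply: (@sub_finite_set _ _ [set x]) => // z [/= zI fz].
    have [df _ sf _] := f'P i.
    have := is_derivative_on_expand df sf zI xI.
    rewrite fz fx subrr normr0 pmulr_rle0?(lt_trans ltr01)// normr_le0 subr_eq0.
    by move/eqP.
  apply: (@sub_finite_set _ _ set0) => // z [/= zI fz].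
  by apply: no; exists z.
- move=> _ Y mY; rewrite I01 setI_bigcupl.
  apply: fin_bigcup_measurable => // i _.
  have [df _ _ _] := f'P i.
  have := subspace_continuous_measurable_fun _ (is_derivative_on_continuous df).
  by apply => //; exact: measurable_itv.
Qed.

(** * Images of open intervals under continuous injective maps *)

Section open_intervals.
Variable R : realType.
Implicit Types (g : R -> R) (a b c d x y u v : R).

Lemma itvoo_IVT g a b x y z :
  (forall t, a < t < b -> {for t, continuous g}) ->
  a < x < b -> a < y < b -> x < y ->
  Num.min (g x) (g y) < z < Num.max (g x) (g y) ->
  exists2 t, x < t < y & g t = z.
Proof.
move=> gc /andP[ax xb] /andP[ay yb] xy /andP[zmin zmax].
have [||t] := @IVT R g x y z (ltW xy).
- apply: continuous_in_subspaceT => t; rewrite inE/= in_itv/= => /andP[xt ty].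
  by apply: gc; rewrite (lt_le_trans ax xt) (le_lt_trans ty yb).
- by rewrite !ltW.
have ends w : w = x \/ w = y -> g w <> z.
  by move=> [->|->] E; move: zmin zmax; rewrite -E gt_min lt_max ltxx ?orbF/= => /lt_trans/[apply];
    rewrite ltxx.
rewrite in_itv/= => /andP[xt ty] gt; exists t => //.
rewrite !lt_neqAle xt ty !andbT; apply/andP; split; apply/eqP => E; apply: (ends t) => //.
  by left.
by right.
Qed.

Lemma itvoo_mono g a b :
  (forall t, a < t < b -> {for t, continuous g}) ->
  (forall x y, a < x < b -> a < y < b -> g x = g y -> x = y) ->
  (forall x y, a < x < b -> a < y < b -> x < y -> g x < g y) \/
  (forall x y, a < x < b -> a < y < b -> x < y -> g y < g x).
Proof.
move=> gc gi.
have [] := @itv_continuous_inj_mono R g `]a, b[.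
- apply: continuous_in_subspaceT => t; rewrite inE/= in_itv/=; exact: gc.
- by move=> x y; rewrite !in_itv/=; exact: gi.
- by move=> H; left => x y xab yab; apply: H; rewrite in_itv.
- by move=> H; right => x y xab yab xy; apply: H; rewrite ?in_itv.
Qed.

Lemma image_itvoo_increasing g a b : a < b ->
  (forall t, a < t < b -> {for t, continuous g}) ->
  (forall x y, a < x < b -> a < y < b -> x < y -> g x < g y) ->
  (forall x, a < x < b -> 0 <= g x <= 1) ->
  exists c d, [/\ 0 <= c, c < d, d <= 1 & g @` `]a, b[%classic = `]c, d[%classic].
Proof.
move=> ab gc gi g01; pose A := g @` `]a, b[%classic.
have Ag x : a < x < b -> A (g x) by move=> xab; exists x => //=; rewrite in_itv.
have mab : a < (a + b) / 2 < b by apply/andP; split; lra.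
have A0 : A !=set0 by exists (g ((a + b) / 2)); exact: Ag.
have lA : lbound A 0.
  by move=> _ [x /=] + <-; rewrite in_itv/= => /g01/andP[].
have uA : ubound A 1.
  by move=> _ [x /=] + <-; rewrite in_itv/= => /g01/andP[].
have hl : has_lbound A by exists 0.
have hu : has_ubound A by exists 1.
have AE : A = `]inf A, sup A[%classic.
  apply/seteqP; split => y /=; rewrite in_itv/=.
    case=> x; rewrite /= in_itv/= => /andP[ax xb] <-.
    have x1 : a < (a + x) / 2 < b by apply/andP; split; lra.
    have x2 : a < (x + b) / 2 < b by apply/andP; split; lra.
    have xab : a < x < b by rewrite ax.
    apply/andP; split.
      apply: (le_lt_trans (ge_inf hl (Ag _ x1))); apply: gi => //; lra.
    apply: (lt_le_trans _ (ub_le_sup hu (Ag _ x2))); apply: gi => //; lra.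
  move=> /andP[yi ys].
  have [_ [x /= xab <-] gxy] := inf_lt A0 yi.
  have [_ [z /= zab <-] gyz] := sup_gt A0 ys.
  move: xab zab; rewrite !in_itv/= => xab zab.
  have xz : x < z.
    rewrite ltNge le_eqVlt; apply/negP => /predU1P[E|zx].
      by move: gxy; rewrite -E ltNge (ltW gyz).
    by have := lt_trans (gi _ _ zab xab zx) (lt_trans gxy gyz); rewrite ltxx.
  have [|t /andP[xt tz] <-] := @itvoo_IVT g a b x z y gc xab zab xz.
    have gxz := lt_trans gxy gyz.
    by rewrite (min_idPl (ltW gxz)) (max_idPr (ltW gxz)) gxy.
  apply: Ag; move: xab zab => /andP[ax _] /andP[_ zb].
  by rewrite (lt_trans ax xt) (lt_trans tz zb).
exists (inf A), (sup A); split; last exact: AE.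
- exact: lb_le_inf.
- have := Ag _ mab; rewrite {1}AE /= in_itv/= => /andP[]; exact: lt_trans.
- exact: ge_sup.
Qed.

Lemma image_itvoo g a b : a < b ->
  (forall t, a < t < b -> {for t, continuous g}) ->
  (forall x y, a < x < b -> a < y < b -> g x = g y -> x = y) ->
  (forall x, a < x < b -> 0 <= g x <= 1) ->
  exists c d, [/\ 0 <= c, c < d, d <= 1 & g @` `]a, b[%classic = `]c, d[%classic].
Proof.
move=> ab gc gi g01; have [gm|gm] := itvoo_mono gc gi.
  exact: image_itvoo_increasing.
(* A decreasing [g] is reflected to [1 - g], which again has values in [0,1]. *)
have [|||c [d [c0 cd d1 E]]] := @image_itvoo_increasing (fun x => 1 - g x) a b ab.
- move=> t tab; apply: cvgB; [exact: cvg_cst|exact: gc].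
- by move=> x y xab yab xy; rewrite ltrD2l ltrN2; exact: gm.
- by move=> x /g01 /andP[? ?]; apply/andP; split; lra.
exists (1 - d), (1 - c); split; [lra|lra|lra|].
have mem z : (`]c, d[%classic z) = ((g @` `]a, b[%classic) (1 - z)).
  rewrite -E; apply/propext; split => -[x xab].
    by move=> <-; exists x => //; lra.
  by move=> gx; exists x => //; lra.
have yE y : 1 - (1 - y) = y by lra.
apply/seteqP; split => y.
  rewrite -{1}(yE y) -mem /= !in_itv/= => /andP[? ?]; apply/andP; split; lra.
rewrite /= in_itv/= => /andP[? ?].
have : `]c, d[%classic (1 - y) by rewrite /= in_itv/=; apply/andP; split; lra.
by rewrite mem yE.
Qed.

Lemma image_itvoo_sub g a b x y :
  (forall t, a < t < b -> {for t, continuous g}) ->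
  (forall x y, a < x < b -> a < y < b -> g x = g y -> x = y) ->
  a < x < b -> a < y < b -> g x < g y ->
  g @` `]Num.min x y, Num.max x y[%classic = `]g x, g y[%classic.
Proof.
move=> gc gi xab yab gxy.
have sub z : Num.min x y < z < Num.max x y -> a < z < b.
  move: xab yab => /andP[? ?] /andP[? ?] /andP[]; rewrite gt_min lt_max.
  by move=> /orP[] ? /orP[] ?; apply/andP; split; lra.
have [gm|gm] := itvoo_mono gc gi.
- have xy : x < y.
    rewrite ltNge le_eqVlt; apply/negP => /predU1P[E|yx].
      by move: gxy; rewrite E ltxx.
    by have := lt_trans gxy (gm _ _ yab xab yx); rewrite ltxx.
  move: sub; rewrite (min_idPl (ltW xy)) (max_idPr (ltW xy)) => sub.
  apply/seteqP; split => z /=.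
    case=> t; rewrite /= in_itv/= => /[dup] /sub tab /andP[xt ty] <-.
    by rewrite in_itv/= !gm.
  rewrite in_itv/= => gz.
  have [|t txy gt] := @itvoo_IVT g a b x y z gc xab yab xy.
    by rewrite (min_idPl (ltW gxy)) (max_idPr (ltW gxy)).
  by exists t => //=; rewrite in_itv.
- have xy : y < x.
    rewrite ltNge le_eqVlt; apply/negP => /predU1P[E|yx].
      by move: gxy; rewrite E ltxx.
    by have := lt_trans gxy (gm _ _ xab yab yx); rewrite ltxx.
  move: sub; rewrite (min_idPr (ltW xy)) (max_idPl (ltW xy)) => sub.
  apply/seteqP; split => z /=.
    case=> t; rewrite /= in_itv/= => /[dup] /sub tab /andP[xt ty] <-.
    by rewrite in_itv/= !gm.
  rewrite in_itv/= => gz.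
  have [|t txy gt] := @itvoo_IVT g a b y x z gc yab xab xy.
    by rewrite (min_idPr (ltW gxy)) (max_idPl (ltW gxy)).
  by exists t => //=; rewrite in_itv.
Qed.

End open_intervals.

(** Puts ]a, b[ inside one branch of f^n. Only the iterates 0 to n - 1 have to miss [C]; the image
    under f^n may meet it. *)
Definition avoids (R : realType) (f : R -> R) (C : set R) (n : nat) (a b : R) : Prop :=
  forall k x, (k < n)%N -> a < x < b -> ~ C (iter k f x).

(** * Iterates on intervals that avoid the cut points *)

Section iterates.
Variables (R : realType) (f : R -> R) (C : set R) (sigma L : R).
Hypothesis Hf : expanding_off f C sigma L.
Implicit Types (n k : nat) (a b c d x y u v : R).

Let sigma0 : 0 < sigma. Proof. by rewrite (lt_trans ltr01)// (exp_gt1 Hf). Qed.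

Lemma iter01 n x : 0 <= x <= 1 -> 0 <= iter n f x <= 1.
Proof.
move=> x01; elim: n => // n IH; rewrite iterS.
by have := exp_itv Hf; move=> /(_ (iter n f x)); rewrite /= !in_itv/=; exact.
Qed.

Lemma iter01_dist n x y : 0 <= x <= 1 -> 0 <= y <= 1 ->
  `|iter n f x - iter n f y| <= 1.
Proof.
move=> /(iter01 n)/andP[? ?] /(iter01 n)/andP[? ?].
by rewrite ler_norml; apply/andP; split; lra.
Qed.

Lemma avoids_sub n a b a' b' : avoids f C n a b -> a <= a' -> b' <= b ->
  avoids f C n a' b'.
Proof.
move=> H aa bb k x kn /andP[ax xb]; apply: H => //.
by rewrite (le_lt_trans aa ax) (lt_le_trans xb bb).
Qed.

Lemma avoids_leq m n a b : avoids f C n a b -> (m <= n)%N -> avoids f C m a b.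
Proof. by move=> H mn k x km; apply: H; exact: leq_trans mn. Qed.

Lemma avoids_add n m a b c d :
  avoids f C n a b -> iter n f @` `]a, b[%classic `<=` `]c, d[%classic ->
  avoids f C m c d -> avoids f C (n + m) a b.
Proof.
move=> H S M k x knm xab; have [kn|nk] := ltnP k n; first exact: H.
rewrite -(subnK nk) iterD; apply: M; first by rewrite ltn_subLR.
have : `]c, d[%classic (iter n f x) by apply: S; exists x => //=; rewrite in_itv.
by rewrite /= in_itv.
Qed.

(** Lets the inductions on [n] peel off the first application of [f] and continue on the image
    interval. *)
Lemma avoids_step n a b : 0 <= a -> a < b -> b <= 1 -> avoids f C n.+1 a b ->
  exists c d, [/\ 0 <= c, c < d, d <= 1, f @` `]a, b[%classic = `]c, d[%classic &
    avoids f C n c d].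
Proof.
move=> a0 ab b1 H; have nC x : a < x < b -> ~ C x by exact: (H 0%N).
have [|||c [d [c0 cd d1 E]]] := @image_itvoo R f a b ab.
- exact: exp_continuous Hf _ _ a0 b1 nC.
- move=> x y xab yab fxy.
  have := exp_expand Hf a0 b1 nC xab yab.
  by rewrite fxy subrr normr0 pmulr_rle0// normr_le0 subr_eq0 => /eqP.
- by move=> x /andP[ax xb]; apply: (@iter01 1%N); apply/andP; split; lra.
exists c, d; split => // k y kn ycd.
have : `]c, d[%classic y by rewrite /= in_itv.
by rewrite -E => -[x /=]; rewrite in_itv/= => xab <-; rewrite -iterSr; exact: H.
Qed.

Lemma step_mem a b c d x : f @` `]a, b[%classic = `]c, d[%classic ->
  a < x < b -> c < f x < d.
Proof.
move=> E xab; have : `]c, d[%classic (f x) by rewrite -E; exists x => //=; rewrite in_itv.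
by rewrite /= in_itv.
Qed.

Lemma avoids_expand n a b : 0 <= a -> a < b -> b <= 1 -> avoids f C n a b ->
  forall x y, a < x < b -> a < y < b ->
  sigma ^+ n * `|x - y| <= `|iter n f x - iter n f y|.
Proof.
elim: n a b => [|n IH] a b a0 ab b1 H x y xab yab; first by rewrite mul1r.
have [c [d [c0 cd d1 E Hn]]] := avoids_step a0 ab b1 H.
rewrite !iterSr; apply: le_trans (IH _ _ c0 cd d1 Hn _ _ (step_mem E xab) (step_mem E yab)).
rewrite exprSr -mulrA ler_wpM2l//; first by rewrite exprn_ge0// ltW.
by apply: (exp_expand Hf a0 b1 _ xab yab) => z; exact: (H 0%N).
Qed.

Lemma avoids_inj n a b : 0 <= a -> a < b -> b <= 1 -> avoids f C n a b ->
  forall x y, a < x < b -> a < y < b -> iter n f x = iter n f y -> x = y.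
Proof.
move=> a0 ab b1 H x y xab yab E; have := avoids_expand a0 ab b1 H xab yab.
by rewrite E subrr normr0 pmulr_rle0 ?exprn_gt0// normr_le0 subr_eq0 => /eqP.
Qed.

Lemma avoids_continuous n a b : 0 <= a -> a < b -> b <= 1 -> avoids f C n a b ->
  forall x, a < x < b -> {for x, continuous (iter n f)}.
Proof.
elim: n a b => [|n IH] a b a0 ab b1 H x xab; first exact: cvg_id.
have [c [d [c0 cd d1 E Hn]]] := avoids_step a0 ab b1 H.
have -> : iter n.+1 f = iter n f \o f by apply/funext => y /=; rewrite -iterS iterSr.
apply: continuous_comp; last exact: (IH _ _ c0 cd d1 Hn _ (step_mem E xab)).
by apply: (exp_continuous Hf a0 b1 _ xab) => z; exact: (H 0%N).
Qed.

Lemma avoids_image n a b : 0 <= a -> a < b -> b <= 1 -> avoids f C n a b ->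
  exists c d, [/\ 0 <= c, c < d, d <= 1 & iter n f @` `]a, b[%classic = `]c, d[%classic].
Proof.
move=> a0 ab b1 H; apply: image_itvoo => //.
- exact: avoids_continuous.
- exact: avoids_inj.
- by move=> x /andP[ax xb]; apply: iter01; apply/andP; split; lra.
Qed.

(** Distances grow by sigma^n and are still at most 1 after n steps. *)
Lemma avoids_small n a b : 0 <= a -> a < b -> b <= 1 -> avoids f C n a b ->
  forall x y, a < x < b -> a < y < b -> `|x - y| <= sigma ^- n.
Proof.
move=> a0 ab b1 H x y xab yab; rewrite -[leRHS]mulr1 ler_pdivlMl ?exprn_gt0//.
apply: (le_trans (avoids_expand a0 ab b1 H xab yab)).
by apply: iter01_dist; [move: xab|move: yab] => /andP[? ?]; apply/andP; split; lra.
Qed.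

(** The distortions of the single steps form a convergent product, since the diameters before these
    steps are at most sigma^-n, ..., sigma^-1. This gives a bound independent of n. *)
Lemma avoids_distortion n a b : 0 <= a -> a < b -> b <= 1 -> avoids f C n a b ->
  forall x y u v, a < x < b -> a < y < b -> a < u < b -> a < v < b ->
  `|iter n f x - iter n f y| * `|u - v| <=
  expR (L / (sigma - 1)) * (`|iter n f u - iter n f v| * `|x - y|).
Proof.
set K := L / (sigma - 1) => a0 ab b1 H x y u v xab yab uab vab.
have s1 : 0 < sigma - 1 by rewrite subr_gt0 (exp_gt1 Hf).
have K0 : 0 <= K by rewrite divr_ge0 ?(exp_lip Hf)// ltW.
(* The exponent is the sum of L sigma^-j over 1 <= j <= n; the induction needs this sharper
   bound. *)
apply: (@le_trans _ _ (expR (K * (1 - sigma ^- n)) *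
    (`|iter n f u - iter n f v| * `|x - y|))); last first.
  rewrite ler_wpM2r ?mulr_ge0// ler_expR ler_piMr// gerBl invr_ge0 exprn_ge0//.
  exact: ltW.
elim: n a b a0 ab b1 H x y u v xab yab uab vab => [|n IH] a b a0 ab b1 H x y u v xab yab uab vab.
  by rewrite /= expr0 invr1 subrr mulr0 expR0 mul1r mulrC.
have [c [d [c0 cd d1 E Hn]]] := avoids_step a0 ab b1 H.
have nC z : a < z < b -> ~ C z by exact: (H 0%N).
have [->|uv] := eqVneq u v; first by rewrite subrr normr0 !mulr0 subrr normr0 mul0r mulr0.
have small := avoids_small a0 ab b1 H.
have D1 := exp_distortion Hf a0 b1 nC small xab yab uab vab.
have Dn := IH _ _ c0 cd d1 Hn _ _ _ _
  (step_mem E xab) (step_mem E yab) (step_mem E uab) (step_mem E vab).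
rewrite !iterSr.
have fuv : 0 < `|f u - f v|.
  apply: lt_le_trans (exp_expand Hf a0 b1 nC uab vab).
  by rewrite mulr_gt0// normr_gt0 subr_eq0.
set E1 := expR _; set En := expR _ in Dn.
(* The first step costs [1 + L sigma^-(n+1)]; by [1 + x <= exp x] the exponents add up exactly. *)
have EE : En * (1 + L * sigma ^- n.+1) <= E1.
  apply: (le_trans (ler_wpM2l (expR_ge0 _) (expR_ge1Dx _))).
  rewrite -expRD ler_expR.
  have -> : L = K * (sigma - 1) by rewrite divfK// gt_eqF.
  rewrite -mulrA -mulrDr ler_wpM2l// mulrBl mul1r addrA -addrA.
  have -> : sigma * sigma ^- n.+1 = sigma ^- n.
    by rewrite exprS invfM mulrA divff ?mul1r// gt_eqF.
  lra.
move: Dn D1; set X := `|iter n f (f x) - _|; set Y := `|iter n f (f u) - _| => Dn D1.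
(* The factor [|f u - f v|] links the two product inequalities. *)
rewrite -(ler_pM2l fuv).
have -> : `|f u - f v| * (X * `|u - v|) = X * `|f u - f v| * `|u - v| by ring.
apply: (le_trans (ler_wpM2r _ Dn)) => //.
have -> : En * (Y * `|f x - f y|) * `|u - v| = En * Y * (`|f x - f y| * `|u - v|) by ring.
apply: (le_trans (ler_wpM2l _ D1)); first by apply: mulr_ge0; [exact: expR_ge0|exact: normr_ge0].
have -> : En * Y * ((1 + L * sigma ^- n.+1) * (`|f u - f v| * `|x - y|)) =
  En * (1 + L * sigma ^- n.+1) * (`|f u - f v| * (Y * `|x - y|)) by ring.
rewrite [X in _ <= X](_ : _ = E1 * (`|f u - f v| * (Y * `|x - y|))); last by ring.
by rewrite ler_wpM2r//; do !apply: mulr_ge0; exact: normr_ge0.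
Qed.

End iterates.

(** * Cut points of iterates, periodic points from full returns, and the covering by pieces with
    large image *)

Section cuts.
Variable R : realType.

Lemma expr_unbounded (s K : R) : 1 < s -> exists n, K <= s ^+ n.
Proof.
move=> s1; have s0 : 0 < s - 1 by rewrite subr_gt0.
have bern n : 1 + n%:R * (s - 1) <= s ^+ n.
  elim: n => [|n IH]; first by rewrite mul0r addr0.
  rewrite exprS; apply: le_trans (ler_wpM2l _ IH); last by rewrite ltW// (lt_trans ltr01).
  rewrite -natr1; have : 0 <= n%:R * (s - 1) * (s - 1) by do !apply: mulr_ge0 => //; exact: ltW.
  by rewrite /=; nra.
exists (Num.bound `|K / (s - 1)|); apply: le_trans (bern _).
have := archi_boundP (normr_ge0 (K / (s - 1))).
move/(le_lt_trans (ler_norm _)); rewrite ltr_pdivrMr// => /ltW/le_trans; apply.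
by rewrite lerDr.
Qed.

Lemma finite_set_separated (A : set R) : finite_set A ->
  exists2 delta, 0 < delta & forall x y, A x -> A y -> x != y -> delta <= `|x - y|.
Proof.
move=> /finite_seqP[s ->].
have Hmin (t : seq R) : exists2 delta, 0 < delta & forall z, z \in t -> 0 < z -> delta <= z.
  elim: t => [|z t [e e0 IH]]; first by exists 1.
  exists (if 0 < z then Num.min e z else e) => [|w].
    by case: ifP => // z0; rewrite lt_min e0.
  rewrite inE => /predU1P[->|wt] w0; first by rewrite w0 ge_min lexx orbT.
  by case: ifP => _; rewrite ?ge_min IH.
have [e e0 eP] := Hmin [seq `|x - y| | x <- s, y <- s]; exists e => // x y xs ys xy.
by apply: eP; [exact: allpairs_f|rewrite normr_gt0 subr_eq0].
Qed.

Lemma itvoo_length_le (a b B : R) : a < b ->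
  (forall x y, a < x < b -> a < y < b -> `|x - y| <= B) -> b - a <= B.
Proof.
move=> ab H; rewrite leNgt; apply/negP => Bab.
have B0 : 0 <= B.
  apply: le_trans (H ((a + b) / 2) ((a + b) / 2) _ _); rewrite ?normr_ge0//;
  by apply/andP; split; lra.
(* This point and the next are at distance (b - a + B) / 2 > B. *)
have x0 : a < a + (b - a - B) / 4 < b by apply/andP; split; lra.
have y0 : a < b - (b - a - B) / 4 < b by apply/andP; split; lra.
by have := H _ _ x0 y0; rewrite distrC ger0_norm; lra.
Qed.

Variables (f : R -> R) (C : set R) (sigma L : R).
Hypothesis Hf : expanding_off f C sigma L.

Definition cuts N : set R :=
  [set x | 0 <= x <= 1 /\ exists2 k, (k < N)%N & C (iter k f x)].

(** A point of [cuts N.+1] lies in [C] or is mapped by [f] into [cuts N], and the fibres of [f] are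
    finite. *)
Lemma finite_cuts N : finite_set (cuts N).
Proof.
elim: N => [|N IH]; first by apply: (@sub_finite_set _ _ set0) => // x [_ []].
apply: (@sub_finite_set _ _ (C `|` \bigcup_(y in cuts N) (`[0, 1]%classic `&` f @^-1` [set y]))).
  move=> x [x01 [[|k] kN Ck]]; [by left|right].
  exists (f x); last by split => //=; rewrite in_itv.
  split; first exact: (iter01 Hf 1%N).
  by exists k => //; rewrite -iterSr.
rewrite finite_setU; split; first exact: exp_finite Hf.
by apply: bigcup_finite => // y _; exact: exp_fiber Hf y.
Qed.

Lemma not_cut_nbhd n x : 0 < x < 1 -> (forall k, (k < n)%N -> ~ C (iter k f x)) ->
  exists e, [/\ 0 < e, 0 <= x - e, x + e <= 1 & avoids f C n (x - e) (x + e)].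
Proof.
move=> /andP[x0 x1]; elim: n => [|n IH] nC.
  exists (Num.min x (1 - x)); rewrite lt_min subr_ge0 -lerBrDl !ge_min !lexx orbT.
  by split => //; rewrite x0 subr_gt0.
have [k kn|e [e0 e1 e2 eP]] := IH; first by apply: nC; rewrite ltnS ltnW.
have xe : x - e < x < x + e by apply/andP; split; lra.
have cf := avoids_continuous Hf e1 (ltac:(lra) : x - e < x + e) e2 eP xe.
have oC : open (~` C).
  apply: closed_openC; apply: (accessible_finite_set_closed.1 _ _ (exp_finite Hf)).
  by apply: hausdorff_accessible; exact: norm_hausdorff.
have nbC : nbhs (iter n f x) (~` C).
  by apply: open_nbhs_nbhs; split => //; exact: nC.
have /nbhs_ballP[r /= r0 rP] := cf _ nbC.
have m0 : 0 < Num.min e r by rewrite lt_min e0.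
have [me mr] : Num.min e r <= e /\ Num.min e r <= r by rewrite !ge_min !lexx orbT.
exists (Num.min e r); split => //; [lra|lra|].
move=> k y; rewrite ltnS leq_eqVlt => /predU1P[->|kn] /andP[y1 y2].
  by apply: rP; rewrite /ball/= ltr_distlC; apply/andP; split; lra.
by apply: eP => //; apply/andP; split; lra.
Qed.

Lemma not_cut_nbhd_open n x (U V : set R) : 0 < x < 1 ->
  (forall k, (k < n)%N -> ~ C (iter k f x)) ->
  open U -> U x -> open V -> V (iter n f x) ->
  exists e, [/\ 0 < e, 0 <= x - e, x + e <= 1, avoids f C n (x - e) (x + e) &
    forall z, x - e <= z <= x + e -> U z /\ V (iter n f z)].
Proof.
move=> x01 nC oU Ux oV Vx; have [e [e0 e1 e2 av]] := not_cut_nbhd x01 nC.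
have xe : x - e < x < x + e by apply/andP; split; lra.
have cf := avoids_continuous Hf e1 (ltac:(lra) : x - e < x + e) e2 av xe.
have /nbhs_ballP[r /= r0 rUV] : nbhs x (U `&` iter n f @^-1` V).
  by apply: filterI; [|apply: cf]; apply: open_nbhs_nbhs.
(* Halved, so that the closed interval of radius [s] lies in the open ball of radius [r]. *)
pose s := Num.min e r / 2.
have s0 : 0 < 2 * s by rewrite mulrC divfK// lt_min e0.
have se : 2 * s <= e by rewrite mulrC divfK// ge_min lexx.
have sr : 2 * s <= r by rewrite mulrC divfK// ge_min lexx orbT.
exists s; split; [lra|lra|lra|by apply: avoids_sub av _ _; lra|].
move=> z /andP[z1 z2]; apply: rUV.
by rewrite /ball/= ltr_distlC; apply/andP; split; lra.
Qed.

(** Two points of ]a, b[ sent into [cuts N] by f^n would have distinct images, by injectivity, at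
    distance less than [delta]. So there is at most one, and it serves as [q]. *)
Lemma avoids_split N delta : 
  (forall x y, cuts N x -> cuts N y -> x != y -> delta <= `|x - y|) ->
  forall n a b c d, 0 <= a -> a < b -> b <= 1 -> avoids f C n a b ->
  iter n f @` `]a, b[%classic = `]c, d[%classic -> d - c < delta ->
  avoids f C (n + N) a b \/
  exists q, [/\ a < q < b, avoids f C (n + N) a q & avoids f C (n + N) q b].
Proof.
move=> Hd n a b c d a0 ab b1 H E cd.
have avoid x : a < x < b -> ~ cuts N (iter n f x) ->
    forall k, (k < n + N)%N -> ~ C (iter k f x).
  move=> /[dup] xab /andP[ax xb] ncut k knN; have [kn|nk] := ltnP k n; first exact: H.
  rewrite -(subnK nk) iterD => Ck; apply: ncut; split.
    by apply: (iter01 Hf); apply/andP; split; lra.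
  by exists (k - n)%N => //; rewrite ltn_subLR.
have [[q [qab qcut]]|no] := pselect (exists q, a < q < b /\ cuts N (iter n f q)); last first.
  by left => k x kn xab; apply: avoid => // cx; apply: no; exists x.
right; exists q; move: (qab) => /andP[aq qb].
have nq x : a < x < b -> x != q -> ~ cuts N (iter n f x).
  move=> xab xq xcut.
  have mem y : a < y < b -> c < iter n f y < d.
    move=> yab; have : `]c, d[%classic (iter n f y).
      by rewrite -E; exists y => //=; rewrite in_itv.
    by rewrite /= in_itv.
  have := Hd _ _ xcut qcut; have /negP : iter n f x != iter n f q.
    by apply: contra xq => /eqP/(avoids_inj Hf a0 ab b1 H xab qab)/eqP.
  move=> /negP xq' /(_ xq'); move: (mem x xab) (mem q qab) => /andP[? ?] /andP[? ?].
  by rewrite leNgt => /negP; apply; rewrite ltr_norml; apply/andP; split; lra.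
split => // k x kn /andP[x1 x2]; apply: avoid => //; try apply: nq; rewrite ?x1 ?x2 ?andbT//=.
- exact: lt_trans x2 qb.
- exact: lt_trans x2 qb.
- by rewrite lt_eqF.
- exact: lt_trans aq x1.
- exact: lt_trans aq x1.
- by rewrite gt_eqF.
Qed.

(** The points [x] and [y] come unordered, since f^n may reverse orientation. *)
Lemma avoids_pullback n a b c d g h : 0 <= a -> a < b -> b <= 1 -> avoids f C n a b ->
  iter n f @` `]a, b[%classic = `]c, d[%classic -> c < g -> g < h -> h < d ->
  exists x y, [/\ a < x < b, a < y < b, iter n f x = g, iter n f y = h &
    iter n f @` `]Num.min x y, Num.max x y[%classic = `]g, h[%classic].
Proof.
move=> a0 ab b1 H E cg gh hd.
have : `]c, d[%classic g by rewrite /= in_itv/= cg (lt_trans gh hd).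
rewrite -E => -[x /=]; rewrite in_itv/= => xab gE.
have : `]c, d[%classic h by rewrite /= in_itv/= hd (lt_trans cg gh).
rewrite -E => -[y /=]; rewrite in_itv/= => yab hE.
exists x, y; split => //; rewrite -gE -hE; 
by apply: (image_itvoo_sub (avoids_continuous Hf a0 ab b1 H)
  (avoids_inj Hf a0 ab b1 H) xab yab); rewrite gE hE.
Qed.

(** Pulling ]y, z[ back by f^n gives ]s, w[ inside ]u, v[, which f^(n+t) maps onto ]c, d[. As ]c, d[
    contains [u, v], the difference f^(n+t)(x) - x changes sign on ]s, w[. *)
Lemma avoids_periodic n t u v g h y z c d :
  0 <= u -> u < v -> v <= 1 -> avoids f C n u v ->
  iter n f @` `]u, v[%classic = `]g, h[%classic -> g < y -> y < z -> z < h ->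
  avoids f C t y z -> iter t f @` `]y, z[%classic = `]c, d[%classic ->
  c < u -> v < d -> exists2 p, u < p < v & iter (n + t) f p = p.
Proof.
move=> u0 uv v1 Hn En gy yz zh Ht Et cu vd.
have [p [q [pI qI _ _ Epq]]] := avoids_pullback u0 uv v1 Hn En gy yz zh.
set s := Num.min p q in Epq; set w := Num.max p q in Epq.
have [us wv] : u < s /\ w < v.
  by move: pI qI => /andP[? ?] /andP[? ?]; rewrite lt_min gt_max; split; apply/andP.
have hit a : c < a < d -> exists2 x, s < x < w & iter (n + t) f x = a.
  move=> acd; have : `]c, d[%classic a by rewrite /= in_itv.
  rewrite -Et => -[b b_yz <-]; have : `]y, z[%classic b by [].
  rewrite -Epq => -[x /=]; rewrite in_itv/= => xI <-.
  by exists x => //; rewrite addnC iterD.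
have [x1 x1I x1E] : exists2 x, s < x < w & iter (n + t) f x = u.
  by apply: hit; rewrite cu (lt_trans uv).
have [x2 x2I x2E] : exists2 x, s < x < w & iter (n + t) f x = v.
  by apply: hit; rewrite vd (lt_trans cu).
have sw : s < w by move: x1I => /andP[/lt_trans h' /h'].
have H : avoids f C (n + t) s w.
  by apply: (avoids_add _ _ Ht); [apply: avoids_sub Hn _ _; apply: ltW|rewrite Epq].
have s0 : 0 <= s := le_trans u0 (ltW us).
have w1 : w <= 1 := le_trans (ltW wv) v1.
have cont x : s < x < w -> {for x, continuous (fun x => iter (n + t) f x - x)}.
  by move=> xI; apply: cvgB; [exact: (avoids_continuous Hf s0 sw w1 H xI)|exact: cvg_id].
have h1 : iter (n + t) f x1 - x1 < 0.
  by rewrite x1E subr_lt0; move: x1I => /andP[/(lt_trans us)].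
have h2 : 0 < iter (n + t) f x2 - x2.
  by rewrite x2E subr_gt0; move: x2I => /andP[_ /lt_trans]; apply.
have fixed x : s < x < w -> iter (n + t) f x - x = 0 ->
    exists2 p, u < p < v & iter (n + t) f p = p.
  move=> /andP[sx xw] /subr0_eq E; exists x => //.
  by rewrite (lt_trans us sx) (lt_trans xw wv).
have between a b x : s < a < w -> s < b < w -> a < x < b -> s < x < w.
  move=> /andP[sa _] /andP[_ bw] /andP[ax xb].
  by rewrite (lt_trans sa ax) (lt_trans xb bw).
have [x12|x21|x12] := ltgtP x1 x2.
- have [|x xI /fixed] := itvoo_IVT cont x1I x2I x12 (z := 0).
    by rewrite gt_min h1 lt_max h2 orbT.
  by apply; exact: between xI.
- have [|x xI /fixed] := itvoo_IVT cont x2I x1I x21 (z := 0).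
    by rewrite gt_min h1 orbT lt_max h2.
  by apply; exact: between xI.
- by move: h1 h2; rewrite x12 => h1 /(lt_trans h1); rewrite ltxx.
Qed.

(* The pieces of ]a0, b0[ that are not yet mapped to large scale after k rounds
   contribute at most 2^-k, which is why phi only has to be controlled on pieces
   with a large image. *)
Lemma avoids_cover : exists2 delta, 0 < delta &
  forall (phi : R -> R -> R) theta a0 b0, 0 <= theta ->
  0 <= a0 -> a0 < b0 -> b0 <= 1 ->
  (forall a b, a0 <= a -> a < b -> b <= b0 -> phi a b <= b - a) ->
  (forall a q b, a0 <= a -> a < q -> q < b -> b <= b0 -> phi a b <= phi a q + phi q b) ->
  (forall n a b c d, a0 <= a -> a < b -> b <= b0 -> avoids f C n a b ->
    0 <= c -> d <= 1 -> iter n f @` `]a, b[%classic = `]c, d[%classic -> delta <= d - c ->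
    phi a b <= theta * (b - a)) ->
  phi a0 b0 <= theta * (b0 - a0).
Proof.
have [N sN] := expr_unbounded 4 (exp_gt1 Hf).
have s0 : 0 < sigma by rewrite (lt_trans ltr01)// (exp_gt1 Hf).
have [delta d0 Hd] := finite_set_separated (finite_cuts N).
exists delta => // phi theta a0 b0 t0 a00 ab0 b01 phi_le phi_add phi_big.
(* Induction on the number [k] of rounds of [N] steps; for [k = 0] the error term bounds the length
   of the piece. *)
have claim k : forall n a b, a0 <= a -> a < b -> b <= b0 -> avoids f C n a b ->
    phi a b <= theta * (b - a) + 2 ^- k * sigma ^- n.
  elim: k => [|k IH] n a b aa ab bb H.
    have a00' : 0 <= a by lra.
    have b01' : b <= 1 by lra.
    have -> : 2 ^- 0 * sigma ^- n = sigma ^- n by rewrite expr0 invr1 mul1r.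
    have : b - a <= sigma ^- n.
      by apply: itvoo_length_le => //; exact: avoids_small Hf _ _ _ _ _ _ _.
    move=> h; apply: (le_trans (phi_le _ _ aa ab bb)).
    by rewrite -[leLHS]add0r lerD// mulr_ge0// subr_ge0 ltW.
  have a00' : 0 <= a by lra.
  have b01' : b <= 1 by lra.
  have [c [d [c0 cd d1 E]]] := avoids_image Hf a00' ab b01' H.
  have e0 : 0 <= 2 ^- k.+1 * sigma ^- n :> R.
    by rewrite mulr_ge0// invr_ge0 exprn_ge0// ltW.
  have [big|small] := leP delta (d - c).
    by rewrite (le_trans (phi_big _ _ _ _ _ aa ab bb H c0 d1 E big))// lerDl.
  have h0 : 0 <= 2 ^- k * sigma ^- (n + N).
    by rewrite mulr_ge0// invr_ge0 exprn_ge0// ltW.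
  (* Two pieces, each with an error smaller by the factor sigma^-N <= 1/4. *)
  have half : 2 * (2 ^- k * sigma ^- (n + N)) <= 2 ^- k.+1 * sigma ^- n.
    have sN4 : sigma ^- N <= 4^-1 by rewrite lef_pV2 ?posrE ?exprn_gt0.
    rewrite exprD exprS !invfM !mulrA [2 * _]mulrC -!mulrA.
    rewrite [2^-1 * _]mulrCA ler_wpM2l ?invr_ge0 ?exprn_ge0//.
    rewrite mulrCA [2^-1 * _]mulrC ler_wpM2l ?invr_ge0 ?exprn_ge0 ?(ltW s0)//.
    lra.
  have [HN|[q [/andP[aq qb] H1 H2]]] := avoids_split Hd a00' ab b01' H E small.
    by have := IH _ _ _ aa ab bb HN; lra.
  have := IH _ _ _ aa aq (ltW (lt_le_trans qb bb)) H1.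
  have := IH _ _ _ (ltW (le_lt_trans aa aq)) qb bb H2.
  have := phi_add _ _ _ aa aq qb bb.
  have -> : b - a = (q - a) + (b - q) by ring.
  by rewrite mulrDr; lra.
(* The claim for n = 0 with k large, as 2^-k <= 1 / (k + 1). *)
rewrite leNgt; apply/negP => /ltr_add_invr[k].
apply/negP; rewrite -leNgt; apply: le_trans (claim k 0%N _ _ _ ab0 _ _) _ => //.
rewrite lerD2l expr0 invr1 mulr1 lef_pV2 ?posrE ?exprn_gt0//.
by rewrite -natrX ler_nat ltn_expl.
Qed.

End cuts.

(** * A uniform grid and a density criterion for null sets *)

Section grid.
Variable R : realType.

Definition grid (M i : nat) : set R := `]i%:R / M%:R, i.+1%:R / M%:R[%classic.

(** With M > 3 / delta the interval is longer than three cells, and the cell after the one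
    containing [c] fits inside with its endpoints. *)
Lemma itv_contains_grid (delta : R) : 0 < delta -> exists2 M, (0 < M)%N &
  forall c d, 0 <= c -> d <= 1 -> delta <= d - c ->
  exists i : 'I_M, c < i%:R / M%:R /\ i.+1%:R / M%:R < d.
Proof.
move=> d0; have q0 : 0 <= 3 / delta by rewrite divr_ge0// ltW.
have := archi_boundP q0; set M := Num.bound _; rewrite ltr_pdivrMr// => HM.
have M0 : (0 < M)%N.
  by rewrite lt0n; apply/eqP => E; move: HM; rewrite E mul0r ltNge ler0n.
have M0' : 0 < M%:R :> R by rewrite ltr0n.
exists M => // c d c0 d1 dcd; have cM0 : 0 <= c * M%:R by rewrite mulr_ge0.
have /andP[t1 t2] := truncn_itv cM0; set t := Num.truncn _ in t1 t2.
have HMd : M%:R * delta <= M%:R * (d - c) by rewrite ler_wpM2l// ltW.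
have t3 : t.+2%:R < d * M%:R.
  have -> : t.+2%:R = t%:R + 2 :> R by rewrite -addn2 natrD.
  lra.
have tM : (t.+1 < M)%N.
  rewrite -(ltr_nat R) (lt_le_trans (_ : _ < t.+2%:R)) ?ltr_nat//.
  by apply: (le_trans (ltW t3)); rewrite ler_piMl// ltW.
by exists (Ordinal tM); rewrite ltr_pdivlMr// ltr_pdivrMr.
Qed.

(** Almost every point of [S] is a density point, whereas [S] fills at most the proportion [theta]
    of small balls. *)
Lemma negligible_sparse (S : set R) (theta : R) : theta < 1 ->
  measurable (S : set (measurableTypeR R)) ->
  (forall a b, 0 <= a -> a < b -> b <= 1 ->
    (lebesgue_measure (S `&` `]a, b[%classic) <= (theta * (b - a))%:E)%E) ->
  lebesgue_measure.-negligible (S `&` `]0, 1[%classic).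
Proof.
move=> t1 mS HS; apply: negligibleS (lebesgue_density mS) => x [Sx /=].
rewrite in_itv/= => /andP[x0 x1] H.
have : ((\1_S x)%:E <= theta%:E)%E.
  apply: (cvge_le _ H); near=> r.
  have r0 : 0 < r by near: r; exact: nbhs_right_gt.
  have xr0 : 0 <= x - r.
    rewrite subr_ge0; near: r; exact: nbhs_right_le.
  have xr1 : x + r <= 1.
    rewrite -lerBrDl; near: r; apply: nbhs_right_le; rewrite subr_gt0//.
  rewrite lebesgue_measure_ball; last exact: ltW.
  rewrite inver mulrn_eq0/= gt_eqF//.
  rewrite lee_pdivrMr// ?mulrn_wgt0// ball_itv.
  apply: (le_trans (HS _ _ xr0 _ xr1)); first lra.
  rewrite -EFinM lee_fin; rewrite le_eqVlt; apply/orP; left; apply/eqP; ring.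
by rewrite indicE mem_set//= lee_fin leNgt t1.
Unshelve. all: by end_near. Qed.

End grid.

(** * Pieces mapped onto grid cells, and closed invariant sets with empty interior *)

Section sparse.
Variables (R : realType) (f : R -> R) (C : set R) (sigma L : R).
Hypothesis Hf : expanding_off f C sigma L.

Lemma avoids_grid : exists2 M, (0 < M)%N & forall a b, 0 <= a -> a < b -> b <= 1 ->
  exists (i : 'I_M) n u v, [/\ a < u, u < v, v < b, avoids f C n u v &
    iter n f @` `]u, v[%classic = @grid R M i].
Proof.
have [delta d0 Hd] := avoids_cover Hf.
have [M M0 HM] := itv_contains_grid d0.
exists M => // a0 b0 a00 ab0 b01; apply: contrapT => no.
suff : b0 - a0 <= 0 * (b0 - a0) by rewrite mul0r; lra.
(* [avoids_cover] with the length as [phi] and [theta = 0]: if no piece were mapped onto a cell,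
   none would have a large image, and b0 - a0 <= 0 would follow. *)
apply: (Hd (fun a b => b - a)) => //; first by move=> *; lra.
move=> n a b c d aa ab bb H c0 d1 E dcd; exfalso; apply: no.
have a0' : 0 <= a := le_trans a00 aa.
have b1' : b <= 1 := le_trans bb b01.
have [i [ci id]] := HM _ _ c0 d1 dcd.
have M0' : 0 < M%:R :> R by rewrite ltr0n.
have [|x [y [xab yab fx fy im]]] := avoids_pullback Hf a0' ab b1' H E ci _ id.
  by rewrite ltr_pM2r ?invr_gt0// ltr_nat.
have xy : x != y.
  have Mn0 : M%:R^-1 != 0 :> R by rewrite invr_eq0 gt_eqF.
  apply/eqP => xy; move: fx; rewrite xy fy => /(mulIf Mn0)/eqP.
  by rewrite eqr_nat gtn_eqF.
exists i, n, (Num.min x y), (Num.max x y); split => //.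
- by move: xab yab => /andP[ax _] /andP[ay _]; rewrite lt_min !(le_lt_trans aa).
- by rewrite gt_min !lt_max !ltxx/= orbF; case: ltgtP xy.
- by move: xab yab => /andP[_ xb] /andP[_ yb]; rewrite gt_max !(lt_le_trans _ bb).
- move: xab yab => /andP[ax xb] /andP[ay yb].
  by apply: avoids_sub H _ _; rewrite ?le_min ?ge_max; apply/andP; split; exact: ltW.
Qed.

(** Here [phi] in [avoids_cover] is the measure of [S] in ]a, b[. A large image contains a cell,
    hence a gap of [S], whose pullback is a gap of [S] filling a fixed proportion of the piece. *)
Lemma closed_invariant_negligible (S : set R) : closed S ->
  (forall a b, 0 <= a -> a < b -> b <= 1 -> exists2 x, a < x < b & ~ S x) ->
  (forall x, 0 <= x <= 1 -> S x -> ~ C x -> S (f x)) ->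
  lebesgue_measure.-negligible (S `&` `]0, 1[%classic).
Proof.
move=> cS Sgap Sf.
have [delta d0 Hd] := avoids_cover Hf.
have [M M0 HM] := itv_contains_grid d0.
have M0' : 0 < M%:R :> R by rewrite ltr0n.
have gapH (i : 'I_M) : exists g : R * R, [/\ i%:R / M%:R < g.1, g.1 < g.2,
    g.2 < i.+1%:R / M%:R & forall x, g.1 < x < g.2 -> ~ S x].
  have [|||x /andP[ix xi] nSx] := Sgap (i%:R / M%:R) (i.+1%:R / M%:R).
  - by rewrite divr_ge0.
  - by rewrite ltr_pM2r ?invr_gt0// ltr_nat.
  - by rewrite ler_pdivrMr// mul1r ler_nat.
  have /nbhs_ballP[r /= r0 rS] : nbhs x (~` S).
    by apply: open_nbhs_nbhs; split => //; exact: closed_openC.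
  pose s := Num.min r (Num.min (x - i%:R / M%:R) (i.+1%:R / M%:R - x)) / 2.
  have : 0 < 2 * s by rewrite mulrC divfK// !lt_min r0 !subr_gt0 ix.
  have : 2 * s <= r by rewrite mulrC divfK// ge_min lexx.
  have : 2 * s <= x - i%:R / M%:R by rewrite mulrC divfK// !ge_min lexx orbT.
  have : 2 * s <= i.+1%:R / M%:R - x by rewrite mulrC divfK// !ge_min lexx !orbT.
  move=> s1 s2 s3 s0; exists (x - s, x + s); split => /=; [lra|lra|lra|].
  move=> y /andP[y1 y2]; apply: rS; rewrite /ball/= ltr_distlC; apply/andP; split; lra.
have [gap gapP] := choice gapH.
have [gam gam0 gamP] : exists2 gam, 0 < gam & forall i, gam <= (gap i).2 - (gap i).1.
  have [i _ iP] := @arg_minP _ _ _ (Ordinal M0) xpredT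
    (fun i => (gap i).2 - (gap i).1) isT.
  exists ((gap i).2 - (gap i).1); first by have [_ ? _ _] := gapP i; rewrite subr_gt0.
  by move=> k; exact: iP.
pose D := expR (L / (sigma - 1)).
have D0 : 0 < D := expR_gt0 _.
(* The minimum with 1 keeps [theta] nonnegative. *)
pose theta := 1 - Num.min 1 (gam / D).
have iterSn n a b : avoids f C n a b -> 0 <= a -> b <= 1 ->
    forall x, a < x < b -> S x -> S (iter n f x).
  move=> H a0 b1 x /[dup] xab /andP[ax xb] Sx; elim: n H => // n IH H.
  apply: Sf; [| |exact: H].
    by apply: (iter01 Hf); apply/andP; split; lra.
  by apply: IH; exact: avoids_leq H _.
have mS : measurable (S : set (measurableTypeR R)).
  by apply: closed_measurable.
have mSI a b : measurable (S `&` `]a, b[%classic : set (measurableTypeR R)).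
  by apply: measurableI => //; exact: measurable_itv.
have muI (a b : R) : a < b -> lebesgue_measure (`]a, b[%classic : set R) = (b - a)%:E.
  by move=> ab; rewrite lebesgue_measure_itv/= lte_fin ab.
have mule a b : a < b -> (lebesgue_measure (S `&` `]a, b[%classic) <= (b - a)%:E)%E.
  move=> ab; rewrite -muI//; apply: le_measure; rewrite ?inE//; exact: measurable_itv.
have fin a b : a < b -> lebesgue_measure (S `&` `]a, b[%classic) \is a fin_num.
  by move=> ab; rewrite ge0_fin_numE// (le_lt_trans (mule _ _ ab))// ltry.
apply: (@negligible_sparse _ S theta) => //.
  by rewrite /theta ltrBlDr ltrDl lt_min ltr01 divr_gt0.
move=> a0 b0 a00 ab0 b01.
rewrite -(fineK (fin _ _ ab0)) lee_fin.
apply: (Hd (fun a b => fine (lebesgue_measure (S `&` `]a, b[%classic)))) => //.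
- by rewrite subr_ge0 ge_min lexx.
- by move=> a b _ ab _; rewrite -lee_fin fineK ?fin// mule.
- move=> a q b _ aq qb _; have ab := lt_trans aq qb.
  rewrite -lee_fin EFinD !fineK ?fin//.
  have sub : S `&` `]a, b[%classic `<=`
      ((S `&` `]a, q[%classic) `|` (S `&` `]q, b[%classic)) `|` [set q].
    move=> x [Sx]; rewrite /= !in_itv/= => /andP[ax xb].
    have [xq|xq|->] := ltgtP x q; [left; left|left; right|by right];
      by split => //; rewrite ?ax ?xb.
  apply: (@le_trans _ _ (lebesgue_measure
      (((S `&` `]a, q[%classic) `|` (S `&` `]q, b[%classic)) `|` [set q]))).
    by apply: le_measure; rewrite ?inE//; do !apply: measurableU => //.
  apply: (le_trans (measureU2 _ _ _)) => //; first exact: measurableU.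
  rewrite -[leRHS]adde0; apply: leeD; first exact: measureU2.
  by rewrite [leLHS](_ : _ = 0%E)//; exact: lebesgue_measure_set1.
move=> n a b c d aa ab bb H c0 d1 E dcd.
have a0' : 0 <= a := le_trans a00 aa.
have b1' : b <= 1 := le_trans bb b01.
have [i [ci id]] := HM _ _ c0 d1 dcd.
have [ig gg gi gS] := gapP i.
have [x [y [xab yab fx fy im]]] :=
  avoids_pullback Hf a0' ab b1' H E (lt_trans ci ig) gg (lt_trans gi id).
set p := Num.min x y in im; set q := Num.max x y in im.
have pq : q - p = `|x - y|.
  rewrite /p /q; case: (leP x y) => xy; last by rewrite ger0_norm// subr_ge0 ltW.
  by rewrite distrC ger0_norm// subr_ge0.
have [ap qb] : a < p /\ q < b.
  move: xab yab => /andP[? ?] /andP[? ?]; rewrite lt_min gt_max.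
  by split; apply/andP; split.
have pq0 : p <= q by rewrite -subr_ge0 pq.
have nS z : p < z < q -> ~ S z.
  move=> /[dup] zpq /andP[pz zq] Sz.
  have zab : a < z < b by rewrite (lt_trans ap pz) (lt_trans zq qb).
  apply: (gS (iter n f z)); last exact: iterSn H a0' b1' _ zab Sz.
  have : `](gap i).1, (gap i).2[%classic (iter n f z).
    by rewrite -im; exists z => //=; rewrite in_itv.
  by rewrite /= in_itv.
(* Bounded distortion compares ]p, q[, whose image has length at least [gam], with ]a, b[, whose
   image has length at most 1. *)
have big : gam / D * (b - a) <= q - p.
  rewrite mulrAC ler_pdivrMr// -ler_pdivlMl//.
  apply: itvoo_length_le => // u v uab vab; rewrite ler_pdivlMl//.
  have := avoids_distortion Hf a0' ab b1' H xab yab uab vab.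
  rewrite -/D fx fy -pq => Dist.
  have ab01 w : a < w < b -> 0 <= w <= 1.
    by move=> /andP[/ltW aw /ltW wb]; rewrite (le_trans a0' aw) (le_trans wb b1').
  have fuv := iter01_dist Hf n (ab01 _ uab) (ab01 _ vab).
  have g1 : gam <= `|(gap i).1 - (gap i).2| by rewrite distrC (le_trans (gamP i))// ler_norm.
  apply: (le_trans (ler_wpM2r (normr_ge0 _) g1)); apply: (le_trans Dist).
  rewrite mulrC ler_wpM2r ?(ltW D0)//.
  by rewrite ler_piMl// subr_ge0.
rewrite -lee_fin fineK ?fin//.
apply: (@le_trans _ _ (lebesgue_measure (`]a, p]%classic `|` `[q, b[%classic : set R))).
  apply: le_measure; rewrite ?inE//; first by apply: measurableU => //; exact: measurable_itv.
  move=> z [Sz]; rewrite /= !in_itv/= => /andP[az zb].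
  have [zp|pz] := leP z p; first by left; rewrite az.
  have [qz|zq] := leP q z; first by right.
  by case: (nS z) => //; rewrite pz.
apply: (le_trans (measureU2 _ _ _)); try exact: measurable_itv.
have E1 : lebesgue_measure (`]a, p]%classic : set R) = (p - a)%:E.
  by rewrite lebesgue_measure_itv/= lte_fin ap.
have E2 : lebesgue_measure (`[q, b[%classic : set R) = (b - q)%:E.
  by rewrite lebesgue_measure_itv/= lte_fin qb.
apply: (@le_trans _ _ ((p - a)%:E + (b - q)%:E)%E).
  by apply: leeD; [rewrite -E1|rewrite -E2].
rewrite -EFinD lee_fin /theta.
have : Num.min 1 (gam / D) * (b - a) <= gam / D * (b - a).
  by rewrite ler_wpM2r ?ge_min ?lexx ?orbT// subr_ge0 ltW.
rewrite mulrBl mul1r; lra.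
Qed.

End sparse.

(** * Sets equal up to null sets, and conditioning *)

Lemma measure_eq_negligibleD d (T : measurableType d) (R : realType)
    (mu : {measure set T -> \bar R}) (A B : set T) :
  measurable A -> measurable B ->
  mu.-negligible (A `\` B) -> mu.-negligible (B `\` A) -> mu A = mu B.
Proof.
move=> mA mB /negligibleP-/(_ (measurableD mA mB)) AB0.
move=> /negligibleP-/(_ (measurableD mB mA)) BA0.
by rewrite (measureDI mu mA mB) (measureDI mu mB mA) setIC; rewrite AB0 BA0.
Qed.

Lemma negligibleD_measure_eq d (T : measurableType d) (R : realType)
    (P : probability T R) (A B : set T) : measurable A -> measurable B ->
  P A = P B -> P.-negligible (A `\` B) -> P.-negligible (B `\` A).
Proof.
move=> mA mB PAB /negligibleP-/(_ (measurableD mA mB)) AB0.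
apply/negligibleP; first exact: measurableD.
have EA : P A = (P (A `\` B) + P (A `&` B))%E := measureDI P mA mB.
have EB : P B = (P (B `\` A) + P (B `&` A))%E := measureDI P mB mA.
move: PAB; rewrite EA EB AB0 add0e setIC.
have fI : P (B `&` A) \is a fin_num by apply: fin_num_measure; exact: measurableI.
have fD : P (B `\` A) \is a fin_num by apply: fin_num_measure; exact: measurableD.
rewrite -(fineK fI) -(fineK fD) -EFinD => -[] E.
have E0 : fine (P (B `\` A)) = 0 by lra.
by rewrite -[LHS](fineK fD) E0.
Qed.

(** The conditional probability given [H]. The second argument of [mnormalize] is its default for
    mass zero or infinity, excluded here. *)
Lemma mnormalize_mrestrE d (T : measurableType d) (R : realType)
    (P : probability T R) (H : set T) (mH : measurable H) (A : set T) :
  P H != 0%E -> mnormalize (mrestr P mH) P A = (P (A `&` H) * (fine (P H))^-1%:E)%E.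
Proof.
move=> PH0; have PHfin : P H \is a fin_num by exact: fin_num_measure.
rewrite /mnormalize /= /mrestr setTI ifF//.
by rewrite (negbTE PH0)/= lt_eqF// ltey_eq PHfin.
Qed.

(** * Open sets and the support *)

Section support.
Variables (R : realType) (mu : probability (measurableTypeR R) R).
Local Notation S := (msupport mu).

Lemma closed_measurableR (A : set R) : closed A -> measurable (A : set (measurableTypeR R)).
Proof. by move=> /closed_openC/open_measurable/measurableC; rewrite setCK. Qed.

Lemma msupport_open_gt0 (U : set R) x : open U -> U x -> S x -> (0 < mu U)%E.
Proof.
move=> oU Ux Sx; rewrite lt_neqAle measure_ge0 andbT eq_sym; apply/eqP => U0.
have : (~` U) x; last by [].
apply: Sx; split; first exact: open_closedC.
by rewrite probability_setC ?U0 ?sube0//; exact: open_measurable.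
Qed.

Lemma msupportC_open (x : R) : ~ S x ->
  exists U, [/\ open U, U x & mu U = 0%E].
Proof.
move=> nSx; exists (~` S); split => //; first exact: closed_openC (@closed_msupport _ mu).
rewrite probability_setC ?msupport_full ?subee//.
exact: closed_measurableR (@closed_msupport _ mu).
Qed.

End support.

(** * Invariance of the support of an acip, and full measure of its interior *)

Section acip.
Variables (R : realType) (f : R -> R) (C : set R) (sigma L : R).
Hypothesis Hf : expanding_off f C sigma L.

Section invariant.
Variables (mu : probability (measurableTypeR R) R) (muf : acip f mu).
Local Notation S := (msupport mu).
Implicit Types A B : set (measurableTypeR R).

Lemma measurable_preimage A : measurable A -> measurable (`[0, 1]%classic `&` f @^-1` A).
Proof. by move=> mA; apply: (exp_measurable Hf) => //; exact: measurable_itv. Qed.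

Lemma iter_preimageS n A : `[0, 1]%classic `&` iter n.+1 f @^-1` A =
  `[0, 1]%classic `&` f @^-1` (`[0, 1]%classic `&` iter n f @^-1` A).
Proof.
apply/seteqP; split => x [x01]; rewrite /preimage/= -iterS iterSr.
  by move=> Ax; split => //; split => //; exact: (exp_itv Hf).
by case=> _ Ax; split.
Qed.

Lemma measurable_iter_preimage n A : measurable A ->
  measurable (`[0, 1]%classic `&` iter n f @^-1` A).
Proof.
move=> mA; elim: n => [|n IH]; first by apply: measurableI => //; exact: measurable_itv.
by rewrite iter_preimageS; exact: measurable_preimage.
Qed.

Lemma acip_full A : measurable A -> mu (`[0, 1]%classic `&` A) = mu A.
Proof.
have [mu1 _ _] := muf; have m01 : measurable (`[0, 1]%classic : set (measurableTypeR R)).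
  exact: measurable_itv.
move=> mA; apply: measure_eq_negligibleD => //; first exact: measurableI.
  by rewrite (_ : _ `\` _ = set0); [exact: negligible_set0|apply/seteqP; split => // x [[]]].
apply: (@negligibleS _ _ _ mu (~` `[0, 1]%classic)); first by move=> x [Ax nA] x01; apply: nA.
apply/negligibleP; first exact: measurableC.
by rewrite [LHS](probability_setC mu m01) mu1 subee.
Qed.

Lemma acip_iter n A : measurable A -> mu (`[0, 1]%classic `&` iter n f @^-1` A) = mu A.
Proof.
have [_ inv _] := muf; move=> mA; elim: n => [|n IH]; first exact: acip_full.
by rewrite iter_preimageS inv//; exact: measurable_iter_preimage.
Qed.

Lemma acip_countable A : countable A -> mu.-negligible A.
Proof.
have [_ _ dom] := muf.
have /(null_content_dominatesP _ _).1 cd := dom.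
move=> cA; have mA : measurable A by exact: countable_measurable.
by apply/negligibleP => //; apply: cd => //; exact: countable_lebesgue_measure0.
Qed.

Lemma msupport01 : S `<=` `[0, 1]%classic.
Proof. by have [mu1 _ _] := muf; apply: msupport_min => //; exact: interval_closed. Qed.

Lemma not_cut_interior x : 0 <= x <= 1 -> ~ C x -> 0 < x < 1.
Proof.
move=> /andP[x0 x1] nC; rewrite !lt_neqAle x0 x1 !andbT; apply/andP; split;
  apply/eqP => E; apply: nC; [rewrite -E; exact: exp_cut0 Hf|rewrite E; exact: exp_cut1 Hf].
Qed.

(** If a null open set [U] contained [f x], a ball around [x] would lie in the preimage of [U],
    which is null by invariance. *)
Lemma msupport_forward x : S x -> ~ C x -> S (f x).
Proof.
move=> Sx nCx; have := msupport01 Sx; rewrite /= in_itv/= => x01.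
apply: contrapT => /msupportC_open[U [oU Ux U0]].
have nC1 k : (k < 1)%N -> ~ C (iter k f x) by case: k.
have [e [e0 e1 e2 _ eU]] := not_cut_nbhd_open Hf (not_cut_interior x01 nCx) nC1
  openT (I : setT x) oU Ux.
have [_ inv _] := muf.
have := msupport_open_gt0 (ball_open x e) (ballxx x e0) Sx.
suff : (mu (ball x e) <= 0)%E by move=> h /lt_le_trans/(_ h); rewrite ltxx.
have <- : mu (`[0, 1]%classic `&` f @^-1` U) = 0%E.
  by rewrite inv//; exact: open_measurable.
apply: le_measure; rewrite ?inE.
- exact: measurable_ball.
- by apply: measurable_preimage; exact: open_measurable.
- move=> y; rewrite /ball/= ltr_distlC => /andP[y1 y2].
  split; first by rewrite /= in_itv/=; apply/andP; split; lra.
  by apply: (eU y _).2; apply/andP; split; exact: ltW.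
Qed.

Lemma msupport_has_interval : exists a b,
  [/\ 0 <= a, a < b, b <= 1 & `]a, b[%classic `<=` S].
Proof.
apply: contrapT => no.
have [_ _ /(null_content_dominatesP _ _).1 dom] := muf.
have mS : measurable (S : set (measurableTypeR R)) := closed_measurableR (@closed_msupport _ mu).
have m01 : measurable (`]0, 1[%classic : set (measurableTypeR R)) by exact: measurable_itv.
have neg : mu.-negligible (S `&` `]0, 1[%classic).
  apply/negligibleP; first exact: measurableI.
  apply: dom; first exact: measurableI.
  apply/negligibleP; first exact: measurableI.
  apply: (closed_invariant_negligible Hf) => //.
  - exact: closed_msupport.
  - move=> a b a0 ab b1; apply: contrapT => H; apply: no; exists a, b; split => //.
    move=> x /=; rewrite in_itv/= => xab; apply: contrapT => nSx; apply: H.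
    by exists x.
  - by move=> x _; exact: msupport_forward.
have : mu.-negligible S.
  apply: (@negligibleS _ _ _ mu ((S `&` `]0, 1[%classic) `|` C)).
    move=> x Sx; have := msupport01 Sx; rewrite /= in_itv/= => x01.
    have [Cx|nCx] := pselect (C x); [by right|left; split => //=].
    by rewrite in_itv/=; exact: not_cut_interior.
  apply: negligibleU => //; apply: acip_countable.
  exact/finite_set_countable/exp_finite/Hf.
move=> /negligibleP-/(_ mS) S0; have /eqP := etrans (esym (msupport_full mu)) S0.
by rewrite onee_eq0.
Qed.

(** Off [C] the map is locally open: a small interval around [x] goes onto an open interval. *)
Lemma interior_msupport_forward x : S° x -> ~ C x -> S° (f x).
Proof.
move=> Sx nCx; have := msupport01 (interior_subset Sx); rewrite /= in_itv/= => x01.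
have nC1 k : (k < 1)%N -> ~ C (iter k f x) by case: k.
have [e [e0 e1 e2 av eS]] := not_cut_nbhd_open Hf (not_cut_interior x01 nCx) nC1
  (@open_interior _ S) Sx openT (I : setT (iter 1 f x)).
have xe : x - e < x + e by lra.
have [c [d [_ cd _ E]]] := avoids_image Hf e1 xe e2 av.
apply: (@filterS _ _ _ `]c, d[%classic).
  rewrite -E => _ [y /=] + <-; rewrite in_itv/= => ye; apply: msupport_forward.
    have ye' : x - e <= y <= x + e by move: ye => /andP[? ?]; apply/andP; split; exact: ltW.
    exact: interior_subset (eS _ ye').1.
  exact: (av 0%N).
apply: near_in_itvoo; have : `]c, d[%classic (f x); last by [].
by rewrite -E; exists x => //=; rewrite in_itv/=; apply/andP; split; lra.
Qed.

End invariant.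

Lemma msupport_interior_full (mu : probability (measurableTypeR R) R) :
  acip f mu -> mu (msupport mu)° = 1%E.
Proof.
move=> muf; have [mu1 inv /(null_content_dominatesP _ _).1 dom] := muf.
set G := (msupport mu)°; apply: contrapT => G1.
pose H : set (measurableTypeR R) := ~` G.
have oG : open G by exact: open_interior.
have mG : measurable (G : set (measurableTypeR R)) by exact: open_measurable.
have mH : measurable H by exact: measurableC.
have m01 : measurable (`[0, 1]%classic : set (measurableTypeR R)) by exact: measurable_itv.
have mfG := measurable_preimage mG.
have negC : mu.-negligible C.
  by apply: (acip_countable muf); exact/finite_set_countable/exp_finite/Hf.
have GG : G `\` (`[0, 1]%classic `&` f @^-1` G) `<=` C.
  move=> x [Gx nfG]; apply: contrapT => nC; apply: nfG; split.
    exact: (msupport01 muf (interior_subset Gx)).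
  exact: interior_msupport_forward.
(* [G] and its preimage have equal measure, so both differences are null once one is; thus [H] is
   invariant up to a null set. *)
have negG : mu.-negligible ((`[0, 1]%classic `&` f @^-1` G) `\` G).
  apply: (negligibleD_measure_eq mG mfG); first by rewrite inv.
  exact: negligibleS negC.
have muH0 : mu H != 0%E.
  apply/eqP => H0; apply: G1; have := probability_setC mu mH.
  by rewrite setCK H0 sube0.
have muHfin : mu H \is a fin_num by exact: fin_num_measure.
pose c := (fine (mu H))^-1.
pose nu : probability (measurableTypeR R) R := mnormalize (mrestr mu mH) mu.
have nuE A : nu A = (mu (A `&` H) * c%:E)%E.
  exact: mnormalize_mrestrE.
have nuf : acip f nu.
  split.
  - rewrite nuE (acip_full muf mH) -{1}(fineK muHfin) -EFinM divff//.
    by rewrite fine_eq0.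
  - move=> A mA; rewrite !nuE; congr (_ * _)%E.
    rewrite -[RHS]inv; last exact: measurableI.
    have mfA := measurable_preimage mA.
    have mfAH := measurable_preimage (measurableI _ _ mA mH).
    apply: measure_eq_negligibleD => //; first exact: measurableI.
    + apply: negligibleS negG => x [[[x01 fAx] Hx] nfAH].
      split; last exact: Hx.
      by split => //; apply: contrapT => nG; apply: nfAH.
    + apply: negligibleS negC => x [[x01 [fAx fHx]] nfAH].
      apply: GG; split; last by case.
      by apply: contrapT => nG; apply: nfAH.
  - apply/null_content_dominatesP => A mA A0; rewrite nuE.
    suff -> : mu (A `&` H) = 0%E by rewrite mul0e.
    apply/eqP; rewrite -measure_le0 -(dom _ mA A0).
    by apply: le_measure; rewrite ?inE//; exact: measurableI.
have [a [b [a0 ab b1 abS]]] := msupport_has_interval nuf.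
have subS : msupport nu `<=` msupport mu.
  move=> x Sx K [cK K1]; apply: Sx; split => //.
  have mK := closed_measurableR cK.
  have nuC : nu (~` K) = 0%E.
    rewrite nuE; suff -> : mu (~` K `&` H) = 0%E by rewrite mul0e.
    apply/eqP; rewrite -measure_le0.
    have <- : mu (~` K) = 0%E by rewrite probability_setC// K1 subee.
    by apply: le_measure; rewrite ?inE//; [apply: measurableI => //|]; exact: measurableC.
  by have := probability_setC nu (measurableC mK); rewrite setCK nuC sube0.
have abG : `]a, b[%classic `<=` G.
  rewrite -open_subsetE; last exact: interval_open.
  exact: subset_trans subS.
have mab : `]a, b[%classic ((a + b) / 2) by rewrite /= in_itv/=; apply/andP; split; lra.
(* ]a, b[ meets the support of [nu], so [nu] charges it; but it lies in [G], disjoint from [H]. *)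
have oab : open (`]a, b[%classic : set R) by exact: interval_open.
have := msupport_open_gt0 oab mab (abS _ mab).
rewrite nuE (_ : _ `&` H = set0) ?measure0 ?mul0e ?ltxx//.
by apply/seteqP; split => // x [/abG].
Qed.

End acip.

(** * Poincare recurrence and a periodic point in every interval *)

Section recurrence.
Variables (R : realType) (f : R -> R) (C : set R) (sigma L : R).
Hypothesis Hf : expanding_off f C sigma L.
Variables (mu : probability (measurableTypeR R) R).
Hypothesis muf : acip f mu.

(** The preimages of [E] under the iterates of f^T are disjoint and of equal measure; more than 1 /
    mu(E) of them would exceed total mass 1. *)
Lemma acip_wandering (T : nat) (E : set (measurableTypeR R)) : measurable E ->
  E `<=` `[0, 1]%classic ->
  (forall j x, (0 < j)%N -> E x -> ~ E (iter (j * T) f x)) -> mu E = 0%E.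
Proof.
move=> mE E01 HE; apply: contrapT => E0.
have fE : mu E \is a fin_num by exact: fin_num_measure.
have E0' : 0 < fine (mu E).
  rewrite -lte_fin fineK// lt_neqAle measure_ge0 andbT; apply/eqP => E00.
  exact: E0 (esym E00).
pose W k : set (measurableTypeR R) := `[0, 1]%classic `&` iter (k * T) f @^-1` E.
have mW k : measurable (W k) by exact: (measurable_iter_preimage Hf).
have muW k : mu (W k) = mu E by exact: (acip_iter Hf muf).
have tW : trivIset setT W.
  apply/trivIsetP => i j _ _; wlog ij : i j / (i < j)%N.
    move=> H; rewrite neq_ltn => /orP[ij|ji]; first by apply: H => //; rewrite ltn_eqF.
    by rewrite setIC; apply: H => //; rewrite ltn_eqF.
  move=> _; apply/seteqP; split => // x [[_ Wi] [_ Wj]].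
  apply: (HE (j - i)%N _ _ Wi); first by rewrite subn_gt0.
  by rewrite -iterD -mulnDl subnK// ltnW.
pose n := (Num.truncn (fine (mu E))^-1).+1.
have : (mu (\big[setU/set0]_(i < n) W i) <= 1)%E.
  by apply: probability_le1; apply: bigsetU_measurable.
have -> : mu (\big[setU/set0]_(i < n) W i) = (\sum_(i < n) mu (W i))%E.
  exact: (measure_bigsetU mu mW tW n).
rewrite (eq_bigr (fun=> (fine (mu E))%:E)); last by move=> i _; rewrite fineK.
rewrite sumEFin lee_fin sumr_const card_ord -mulr_natl leNgt => /negP; apply.
by rewrite -ltr_pdivrMr// div1r truncnS_gt.
Qed.

(** Poincare recurrence for f^T. The points whose orbit meets [C] form a null set, so the returning
    point can also be chosen off it. *)
Lemma acip_recurrence (T : nat) (J : set (measurableTypeR R)) : measurable J ->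
  (0 < mu J)%E -> exists x j, [/\ J x, 0 <= x <= 1, forall k, ~ C (iter k f x),
    (0 < j)%N & J (iter (j * T) f x)].
Proof.
move=> mJ J0; apply: contrapT => no.
pose E : set (measurableTypeR R) := (`[0, 1]%classic `&` J) `\`
  \bigcup_j (`[0, 1]%classic `&` iter (j.+1 * T) f @^-1` J).
have m01 : measurable (`[0, 1]%classic : set (measurableTypeR R)) by exact: measurable_itv.
have mE : measurable E.
  apply: measurableD; first exact: measurableI.
  by apply: bigcup_measurable => j _; exact: (measurable_iter_preimage Hf).
have E0 : mu E = 0%E.
  apply: (@acip_wandering T) => //; first by move=> x [[]].
  move=> [//|j] x _ [[x01 _] nE] [[_ Jx] _]; apply: nE.
  by exists j.
have Cneg : mu.-negligible (\bigcup_k (`[0, 1]%classic `&` iter k f @^-1` C)).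
  apply: negligible_bigcup => k.
  have mC : measurable (C : set (measurableTypeR R)).
    by apply: countable_measurable => //; exact/finite_set_countable/exp_finite/Hf.
  apply/negligibleP; first exact: (measurable_iter_preimage Hf).
  rewrite [LHS](acip_iter Hf muf)//; apply/negligibleP => //.
  by apply: (acip_countable muf); exact/finite_set_countable/exp_finite/Hf.
have : mu.-negligible (`[0, 1]%classic `&` J).
  apply: (@negligibleS _ _ _ mu (E `|` \bigcup_k (`[0, 1]%classic `&` iter k f @^-1` C))).
    move=> x [x01 Jx].
    have [Cx|nCx] := pselect ((\bigcup_k (`[0, 1]%classic `&` iter k f @^-1` C)) x); first by right.
    left; split => // -[j _ [_ Jj]]; apply: no; exists x, j.+1; split => //.
    by move=> k Ck; apply: nCx; exists k.
  by apply: negligibleU => //; apply/negligibleP.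
move=> /negligibleP-/(_ (measurableI _ _ m01 mJ)) H.
by move: J0; rewrite -(acip_full muf mJ) H ltxx.
Qed.

Lemma itvoo_subset (a b c d : R) : c < d ->
  `]c, d[%classic `<=` `]a, b[%classic -> a <= c /\ d <= b.
Proof.
move=> cd H.
have mem z : c < z < d -> a < z < b.
  by move=> zcd; have := H z; rewrite /= !in_itv/=; apply.
split; rewrite leNgt; apply/negP => ac.
  have m1 : Num.min a d <= a by rewrite ge_min lexx.
  have m2 : Num.min a d <= d by rewrite ge_min lexx orbT.
  have m3 : c < Num.min a d by rewrite lt_min ac.
  have /mem/andP[? ?] : c < (c + Num.min a d) / 2 < d by apply/andP; split; lra.
  lra.
have m1 : b <= Num.max b c by rewrite le_max lexx.
have m2 : c <= Num.max b c by rewrite le_max lexx orbT.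
have m3 : Num.max b c < d by rewrite gt_max ac.
have /mem/andP[? ?] : c < (Num.max b c + d) / 2 < d by apply/andP; split; lra.
lra.
Qed.

Definition reach M (a b : R) : {set 'I_M} := [set i : 'I_M | `[< exists n u v,
  [/\ a < u, u < v, v < b, avoids f C n u v &
    iter n f @` `]u, v[%classic = @grid R M i] >]]%SET.

Lemma reach_sub M a b a' b' : a <= a' -> b' <= b ->
  (reach M a' b' \subset reach M a b)%SET.
Proof.
move=> aa bb; apply/fintype.subsetP => i; rewrite !inE => -[n [u [v [au uv vb H E]]]].
exists n, u, v; split => //; lra.
Qed.

(** A subinterval reaches a subset of the same finitely many cells, so the number of cells cannot
    drop forever. *)
Lemma reach_minimal M (a b : R) : a < b -> exists a1 b1, [/\ a <= a1, a1 < b1, b1 <= b &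
  forall a' b', a1 <= a' -> a' < b' -> b' <= b1 -> reach M a' b' = reach M a1 b1].
Proof.
have [n] := ubnP #|reach M a b|; elim: n a b => // n IH a b; rewrite ltnS => cn ab.
have [H|/existsNP[a' /existsNP[b' H]]] := pselect (forall a' b', a <= a' -> a' < b' -> b' <= b ->
    reach M a' b' = reach M a b).
  by exists a, b.
have [aa [ab' [bb ne]]] : a <= a' /\ a' < b' /\ b' <= b /\ reach M a' b' <> reach M a b.
  by do 3 move/not_implyP : H => [? H].
have [|a1 [b1 [? ? ? ?]]] := IH a' b' _ ab'.
  apply: leq_trans cn; apply: proper_card; rewrite finset.properEneq reach_sub// andbT.
  exact/eqP.
by exists a1, b1; split => //; lra.
Qed.

Lemma periodic_point_itvoo (a b : R) : 0 <= a -> a < b -> b <= 1 ->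
  (forall u v, a <= u -> u < v -> v <= b -> (0 < mu `]u, v[%classic)%E) ->
  exists p n, [/\ a < p < b, (0 < n)%N & iter n f p = p].
Proof.
move=> a0 ab b1 pos; have [M M0 HM] := avoids_grid Hf.
have [a1 [b1' [aa1 ab1 bb1 min1]]] := reach_minimal M ab.
have [||i [n [u [v [au uv vb Huv Euv]]]]] := HM a1 b1' _ ab1 _; [lra|lra|].
have iR : i \in reach M a1 b1' by rewrite !inE; exists n, u, v.
(* Recurrence for f^(n+1) makes the return time j (n + 1) exceed [n], so the orbit passes through
   the cell at time [n] before it returns. *)
have [|x [j [xJ x01 nC j0 xjJ]]] := @acip_recurrence n.+1 `]u, v[%classic (measurable_itv _).
  by apply: pos; lra.
pose y := iter n f x; pose t := (j * n.+1 - n)%N.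
have nj : (n < j * n.+1)%N by rewrite (leq_trans (ltnSn n))// leq_pmull.
have t0 : (0 < t)%N by rewrite subn_gt0.
have ty : iter t f y = iter (j * n.+1) f x by rewrite /y -iterD subnK// ltnW.
have nCy k : ~ C (iter k f y) by rewrite /y -iterD; exact: nC.
have y01 : 0 < y < 1.
  by apply: (not_cut_interior Hf); [exact: (iter01 Hf)|exact: (nCy 0%N)].
have yG : @grid R M i y by rewrite -Euv; exists x.
have oG : open (@grid R M i) by exact: interval_open.
have ouv : open (`]u, v[%classic : set R) by exact: interval_open.
have [|e [e0 e1 e2 av eP]] := not_cut_nbhd_open Hf (n := t) y01 (fun k _ => nCy k) oG yG ouv.
  by rewrite ty.
have ye : y - e < y + e by lra.
have [c [d [c0 cd d1 EY]]] := avoids_image Hf e1 ye e2 av.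
have [uc dv] : u <= c /\ d <= v.
  apply: itvoo_subset => //; rewrite -EY => _ [z /=] + <-; rewrite in_itv/= => /andP[z1 z2].
  by apply: (eP z _).2; apply/andP; split; exact: ltW.
(* ]c, d[ lies in ]u, v[, hence in the interval with minimal [reach], and reaches the same cells. *)
have : i \in reach M c d.
  by rewrite min1 ?(le_trans (ltW au))// (le_trans dv)// ltW.
rewrite !inE => -[m [u3 [v3 [cu3 uv3 vd3 H3 E3]]]].
have [/andP[gm _] /andP[_ gp]] : i%:R / M%:R < y - e < i.+1%:R / M%:R /\
    i%:R / M%:R < y + e < i.+1%:R / M%:R.
  have m1 : y - e <= y - e <= y + e by rewrite lexx ltW.
  have m2 : y - e <= y + e <= y + e by rewrite lexx ltW.
  by have := (eP _ m1).1; have := (eP _ m2).1; rewrite /grid /= !in_itv.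
have [p /andP[up pv] pE] := avoids_periodic Hf (le_trans c0 (ltW cu3)) uv3
  (le_trans (ltW vd3) d1) H3 E3 gm ye gp av EY cu3 vd3.
exists p, (m + t)%N; split; [|by rewrite addn_gt0 t0 orbT|exact: pE].
by apply/andP; split; clear -aa1 bb1 au vb uc dv cu3 vd3 up pv; lra.
Qed.

End recurrence.

(** * Density of the periodic points in the support *)

Theorem theorem1p2 (R : realType) (m : nat) (f : R -> R)
    (f01 : set_fun `[0, 1]%classic `[0, 1]%classic f)
    (fexp : piecewise_expanding m f)
    (mu : probability (measurableTypeR R) R) (muf : acip f mu) :
  msupport mu `<=` closure (periodic_points f `&` msupport mu).
Proof.
have [C [sigma [L Hf]]] := piecewise_expanding_off f01 fexp.
move=> x Sx B nB; pose G := (msupport mu)°.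
have oB : open B° by exact: open_interior.
have oG : open G by exact: open_interior.
have mG : measurable (G : set (measurableTypeR R)) by exact: open_measurable.
(* The interior of [B] has positive measure and [G] has full measure. *)
have [z [Bz Gz]] : exists z, B° z /\ G z.
  apply: contrapT => no; have := msupport_open_gt0 oB nB Sx.
  suff -> : mu B° = 0%E by rewrite ltxx.
  apply/eqP; rewrite -measure_le0.
  have <- : mu (~` G) = 0%E.
    by rewrite probability_setC// (msupport_interior_full Hf muf) subee.
  apply: le_measure; rewrite ?inE; [exact: open_measurable|exact: measurableC|].
  by move=> z Bz Gz; apply: no; exists z.
have /nbhs_ballP[r /= r0 rBG] : nbhs z (B° `&` G).
  by apply: open_nbhs_nbhs; split => //; exact: openI.
have sub w : z - r < w < z + r -> [/\ B w, msupport mu w & 0 <= w <= 1].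
  move=> zw; have [Bw Gw] : (B° `&` G) w by apply: rBG; rewrite /ball/= ltr_distlC.
  have Sw : msupport mu w := interior_subset Gw.
  split => //; first exact: interior_subset Bw.
  by have := msupport01 muf Sw; rewrite /= in_itv.
(* Half the radius keeps the endpoints, too, in [B] and in the support, hence in [0,1]. *)
have [_ _ /andP[a0 _]] : [/\ B (z - r / 2), msupport mu (z - r / 2) & 0 <= z - r / 2 <= 1].
  by apply: sub; apply/andP; split; lra.
have [_ _ /andP[_ b1]] : [/\ B (z + r / 2), msupport mu (z + r / 2) & 0 <= z + r / 2 <= 1].
  by apply: sub; apply/andP; split; lra.
have [|u v au uv vb|p [n [pI n0 pE]]] := @periodic_point_itvoo R f C sigma L Hf mu muf _ _ a0 _ b1.
- lra.
- have [_ Sm _] : [/\ B ((u + v) / 2), msupport mu ((u + v) / 2) & 0 <= (u + v) / 2 <= 1].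
    by apply: sub; apply/andP; split; lra.
  apply: (msupport_open_gt0 _ _ Sm); first exact: interval_open.
  by rewrite /= in_itv/=; apply/andP; split; lra.
- have [Bp Sp p01] : [/\ B p, msupport mu p & 0 <= p <= 1].
    by apply: sub; move: pI => /andP[? ?]; apply/andP; split; lra.
  by exists p; split => //; split => //; split; [rewrite in_itv|exists n].
Qed.
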